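(* Let $d\ge 1$ and $1\le m<g-d$. Let $Q\sim\mathcal{N}(0,I_{m+d})$ and define the random variable $$X=x_0+V_{1:m+d}\,\Phi_{1:m+d}^{1/2}\,Q\in\mathbb{R}^n .$$ Then $X$ is distributed according to $$\mathcal{N}\left(x_0,\ V_{1:m+d}\Phi_{1:m+d}V_{1:m+d}^T\right),$$ which is the rank-$(m+d)$ approximation of the Krylov prior. Moreover, $X$ conditioned on the random variable $Y=V_{1:m}^TAX$ taking the value $V_{1:m}^Tb$ is distributed according to $$\mathcal{N}\left(x_m,\ V_{m+1:m+d}\Phi_{m+1:m+d}V_{m+1:m+d}^T\right)=\mathcal{N}(x_m,\widehat\Gamma_m),$$ which is the rank-$d$ approximation of the Krylov posterior $\eta_m$.
   Context: Let $A\in\mathbb{R}^{n\times n}$ be symmetric positive definite, $b\in\mathbb{R}^n$, $Ax_*=b$, $x_0\in\mathbb{R}^n$ an initial guess, and $r_0=b-Ax_0$ (nonzero). Let $\mathcal{K}_i(A,r_0)=\operatorname{span}\{r_0,Ar_0,\ldots,A^{i-1}r_0\}$, and let $g\le n$ be the grade of $r_0$ with respect to $A$: the minimum value with $\mathcal{K}_g(A,r_0)=\mathcal{K}_{g+i}(A,r_0)$ for all $i\ge 1$. Krylov prior: let $V=[v_1\ \cdots\ v_g]\in\mathbb{R}^{n\times g}$ satisfy $V^TAV=I_g$ and $\operatorname{span}\{v_1,\ldots,v_i\}=\mathcal{K}_i(A,r_0)$ for $1\le i\le g$; let $\phi_i=(v_i^Tr_0)^2$ and $\Phi=\operatorname{diag}(\phi_1,\ldots,\phi_g)$.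 The Krylov prior is $\eta_0=\mathcal{N}(x_0,\Gamma_0)$ with $\Gamma_0=V\Phi V^T$. Write $V_{i:j}=[v_i\ \cdots\ v_j]$ and $\Phi_{i:j}=\operatorname{diag}(\phi_i,\ldots,\phi_j)$. The rank-$k$ approximation of the Krylov prior is $\mathcal{N}(x_0,V_{1:k}\Phi_{1:k}V_{1:k}^T)$. Krylov posteriors (those produced by the solver BayesCG under the Krylov prior): $\eta_m=\mathcal{N}(x_m,\Gamma_m)$ with $x_m=x_0+V_{1:m}V_{1:m}^Tr_0$ and $\Gamma_m=V_{m+1:g}\Phi_{m+1:g}V_{m+1:g}^T$, $1\le m<g$. The rank-$d$ approximation of $\eta_m$ is $\widehat\eta_m=\mathcal{N}(x_m,\widehat\Gamma_m)$ with $\widehat\Gamma_m=V_{m+1:m+d}\Phi_{m+1:m+d}V_{m+1:m+d}^T$, where $d\ge 1$ and $1\le m<g-d$. $\mathcal{N}(x,\Sigma)$ is the Gaussian distribution with mean $x$ and (possibly singular) covariance $\Sigma$. For the jointly Gaussian pair $(X,Y)$, the conditional distribution of $X$ given $Y=y$ means the usual version of the regular conditional distribution, continuous in $y$. *)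

(* Defs.v *)
From HB Require Import structures.
From mathcomp Require Import all_boot all_order all_algebra.
From mathcomp Require Import all_classical all_reals all_analysis.

Set Implicit Arguments.
Unset Strict Implicit.
Unset Printing Implicit Defensive.

Import Order.TTheory GRing.Theory Num.Theory.
Import numFieldNormedType.Exports.

Local Open Scope classical_set_scope.
Local Open Scope ring_scope.

(* Real matrices, in particular the column vectors 'cV[R]_n, carry the Borel
   sigma-algebra of the library's (product) topology on 'M[R]_(m, n). *)
Section borel_matrix.
Variables (R : realType) (m n : nat).

HB.instance Definition _ := @isMeasurable.Build
  (sigma_display (@open 'M[R]_(m, n))) 'M[R]_(m, n) <<s @open 'M[R]_(m, n) >>
  (@sigma_algebra0 _ setT _) (@sigma_algebraC _ _)
  (@sigma_algebra_bigcup _ setT _).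

End borel_matrix.

Lemma continuous_mx_measurable (R : realType) (m n p q : nat)
    (f : 'M[R]_(m, n) -> 'M[R]_(p, q)) :
  continuous f -> measurable_fun setT f.
Proof.
move=> /continuousP cf.
apply: (@measurability _ _ _ _ setT f (@open 'M[R]_(p, q))) => //.
move=> _ [U oU <-]; rewrite setTI.
exact: (@sub_sigma_algebra _ setT (@open 'M[R]_(m, n)) _ (cf _ oU)).
Qed.

Lemma continuous_mulmx (R : realType) (n k : nat) (B : 'M[R]_(n, k)) :
  continuous (mulmx B : 'cV[R]_k -> 'cV[R]_n).
Proof.
have cB i j : continuous (fun y : 'cV[R]_k => (B *m y) i j).
  rewrite (_ : (fun y : 'cV_k => _) = fun y => \sum_l B i l * y l j).
    apply: continuous_big => [|l _ y]; first exact: add_continuous.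
    apply: (@cvgM R _ (nbhs y) _ (fun=> B i l) (fun y : 'cV[R]_k => y l j)).
      exact: cvg_cst.
    exact: coord_continuous.
  by apply/funext => y; rewrite mxE.
move=> z A [P Pz PA].
have Pzij (ij : 'I_n * 'I_1) :
    nbhs z [set y : 'cV[R]_k | P ij.1 ij.2 ((B *m y) ij.1 ij.2)].
  exact: cB (Pz ij.1 ij.2).
apply: (@filterS _ (nbhs z) _ _ _ _ (filter_forall _ Pzij)) => y Py.
by apply: PA => i j; exact: (Py (i, j)).
Qed.

Definition affine_map (R : realType) (n k : nat) (x : 'cV[R]_n)
  (B : 'M[R]_(n, k)) (z : 'cV[R]_k) : 'cV[R]_n := x + B *m z.

Lemma continuous_affine_map (R : realType) (n k : nat) (x : 'cV[R]_n)
  (B : 'M[R]_(n, k)) : continuous (affine_map x B).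
Proof.
move=> z; apply: (@cvgD R _ _ (nbhs z) _ (fun=> x) (mulmx B)).
  exact: cvg_cst.
exact: continuous_mulmx.
Qed.

HB.instance Definition _ (R : realType) (n k : nat) (B : 'M[R]_(n, k)) :=
  isMeasurableFun.Build _ _ _ _ (mulmx B : 'cV[R]_k -> 'cV[R]_n)
    (continuous_mx_measurable (@continuous_mulmx R n k B)).

HB.instance Definition _ (R : realType) (n k : nat) (x : 'cV[R]_n)
    (B : 'M[R]_(n, k)) :=
  isMeasurableFun.Build _ _ _ _ (affine_map x B)
    (continuous_mx_measurable (@continuous_affine_map R n k x B)).

Section gaussian.
Variable R : realType.

(* The univariate N(a, s2).  The degenerate case has to be separated, since
   [normal_prob a 0] is not the Dirac measure at [a]. *)
Definition normal_law1 (a s2 : R) : set R -> \bar R :=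
  if s2 == 0 then \d_a else normal_prob a (Num.sqrt s2).

Definition covariance_matrix (n : nat) (S : 'M[R]_n) : Prop :=
  S^T = S /\ forall t : 'cV[R]_n, 0 <= (t^T *m S *m t) 0 0.

(* mu = N(x, S) on R^n, for a possibly singular covariance matrix S: under mu,
   every linear functional z |-> t^T z is univariate normal, with mean t^T x
   and variance t^T S t. *)
Definition gaussian (n : nat) (mu : {measure set 'cV[R]_n -> \bar R})
    (x : 'cV[R]_n) (S : 'M[R]_n) : Prop :=
  covariance_matrix S /\
  forall (t : 'cV[R]_n) (B : set R), measurable B ->
    mu ((fun z : 'cV[R]_n => (t^T *m z) 0 0) @^-1` B) =
    normal_law1 ((t^T *m x) 0 0) ((t^T *m S *m t) 0 0) B.

End gaussian.

Section conditioning.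
Context (R : realType) (n k : nat) (d : measure_display) (T : measurableType d)
  (P : probability T R).

Definition regular_conditional (X : {RV P >-> 'cV[R]_n})
    (Y : {RV P >-> 'cV[R]_k}) (K : R.-pker 'cV[R]_k ~> 'cV[R]_n) : Prop :=
  forall (B : set 'cV[R]_n) (C : set 'cV[R]_k), measurable B -> measurable C ->
    P (X @^-1` B `&` Y @^-1` C) = (\int[distribution P Y]_(y in C) K y B)%E.

Definition weakly_continuous (K : R.-pker 'cV[R]_k ~> 'cV[R]_n) : Prop :=
  forall f : 'cV[R]_n -> R, continuous f ->
    (exists M : R, forall z, `|f z| <= M) ->
    continuous (fun y => \int[K y]_z f z).

(* Continuity singles out one of the almost surely equal versions on the
   support of the law of Y. *)
Definition continuous_conditional (X : {RV P >-> 'cV[R]_n})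
    (Y : {RV P >-> 'cV[R]_k}) (K : R.-pker 'cV[R]_k ~> 'cV[R]_n) : Prop :=
  regular_conditional X Y K /\ weakly_continuous K.

End conditioning.

Section krylov.
Context (R : realType) (n : nat).

Definition sym_pos_def (A : 'M[R]_n) : Prop :=
  A^T = A /\ forall t : 'cV[R]_n, t != 0 -> 0 < (t^T *m A *m t) 0 0.

Definition krylov (A : 'M[R]_n) (r : 'cV[R]_n) (i : nat) : {vspace 'cV[R]_n} :=
  <<[seq A ^+ j *m r | j <- iota 0 i]>>%VS.

Definition grade (A : 'M[R]_n) (r : 'cV[R]_n) (g : nat) : Prop :=
  let stationary h :=
    forall i, (1 <= i)%N -> krylov A r h = krylov A r (h + i) in
  stationary g /\ forall h, stationary h -> (g <= h)%N.

(* Families v_1, v_2, ... are indexed from 1 as in the literature; only the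
   values v i with 1 <= i <= g matter.  [cols v o k] is the n x k matrix
   [v_(o+1) ... v_(o+k)], i.e. V_(o+1 : o+k). *)
Definition cols (v : nat -> 'cV[R]_n) (o k : nat) : 'M[R]_(n, k) :=
  \matrix_(i < n, j < k) v (o + j).+1 i 0.

Definition krylov_basis (A : 'M[R]_n) (r : 'cV[R]_n) (g : nat)
    (v : nat -> 'cV[R]_n) : Prop :=
  (cols v 0 g)^T *m A *m cols v 0 g = 1%:M /\
  forall i, (1 <= i <= g)%N ->
    <<[seq v j | j <- iota 1 i]>>%VS = krylov A r i.

Definition phi (r : 'cV[R]_n) (v : nat -> 'cV[R]_n) (i : nat) : R :=
  (((v i)^T *m r) 0 0) ^+ 2.

(* Phi_(o+1 : o+k) and its square root. *)
Definition Phi (r : 'cV[R]_n) (v : nat -> 'cV[R]_n) (o k : nat) : 'M[R]_k :=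
  diag_mx (\row_(j < k) phi r v (o + j).+1).

Definition sqrtPhi (r : 'cV[R]_n) (v : nat -> 'cV[R]_n) (o k : nat) :
    'M[R]_k :=
  diag_mx (\row_(j < k) Num.sqrt (phi r v (o + j).+1)).

Definition prior_approx_cov (r : 'cV[R]_n) (v : nat -> 'cV[R]_n) (k : nat) :
    'M[R]_n :=
  cols v 0 k *m Phi r v 0 k *m (cols v 0 k)^T.

Definition posterior_mean (x0 r : 'cV[R]_n) (v : nat -> 'cV[R]_n) (m : nat) :
    'cV[R]_n :=
  x0 + cols v 0 m *m (cols v 0 m)^T *m r.

Definition posterior_approx_cov (r : 'cV[R]_n) (v : nat -> 'cV[R]_n)
    (m d : nat) : 'M[R]_n :=
  cols v m d *m Phi r v m d *m (cols v m d)^T.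

End krylov.

(* Main.v *)
Require Import Defs.
From HB Require Import structures.
From mathcomp Require Import all_boot all_order all_algebra.
From mathcomp Require Import all_classical all_reals all_analysis.
From mathcomp Require Import measurable_realfun lebesgue_integral_under.
From mathcomp Require Import ring lra.
Set Implicit Arguments.
Unset Strict Implicit.
Unset Printing Implicit Defensive.
Import Order.TTheory GRing.Theory Num.Theory.
Import numFieldNormedType.Exports.
Local Open Scope classical_set_scope.
Local Open Scope ring_scope.

(** Split Q into its blocks Q1 of size m and Q2 of size d, and let
    c = V_(1:m)^T A x0. As V^T A V = I, the map V_(1:m)^T A sends V_(1:m) to the
    identity and V_(m+1:m+d) to 0, so
      Y = c + Phi_(1:m)^(1/2) Q1   and
      X = x0 + V_(1:m) (Y - c) + V_(m+1:m+d) Phi_(m+1:m+d)^(1/2) Q2.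
    Since Q1 and Q2 are independent, the conditional law of X given Y = y is that
    of x0 + V_(1:m) (y - c) + V_(m+1:m+d) Phi_(m+1:m+d)^(1/2) Q2. This family
    ([affine_kernel]) consists of Gaussian laws, is a version of the conditional
    law ([affine_kernel_regular_conditional]) and is weakly continuous in y
    ([affine_kernel_weakly_continuous]). At y = V_(1:m)^T b one has
    y - c = V_(1:m)^T r0, so that the mean is x_m.

    Two points carry the proof.

    Independence. Gaussian laws are given by their one-dimensional projections, so
    the joint law has to be recovered from these. The expectations of
    cos (t.x + p) determine a probability on R^n ([cos_expectations_determine]),
    those of a Gaussian are explicit ([normal_cos], [gaussian_cos]), and they
    agree for the law of (Q1, Q2) and for the product of the laws of Q1 and Q2
    ([standard_gaussian_blocks]).

    Uniqueness. Two versions of the conditional law agree for almost every y; if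
    both are weakly continuous they agree at every point all of whose
    neighbourhoods are charged by the law of Y ([continuous_conditional_unique]).
    The point V_(1:m)^T b is of this kind: it is the value of Y when the entries
    of Q1 are the signs of v_i^T r0, and a standard Gaussian charges every
    neighbourhood of every point ([standard_gaussian_box_gt0]). *)

(** * Bounded measurable functions *)

Section bounded_measurable.
Context d (T : measurableType d) (R : realType).
Implicit Types (f g : T -> R) (P : probability T R).

(** Boundedness makes every integral against a probability finite, so that
    expectations can be manipulated as plain real numbers. *)
Definition bounded_measurable f :=
  measurable_fun setT f /\ exists M, forall x, `|f x| <= M.

Lemma bounded_measurable_integrable P f :
  bounded_measurable f -> P.-integrable setT (EFin \o f).
Proof.
move=> [mf [M fM]]; apply: measurable_bounded_integrable => //.
  by rewrite -[ltLHS]/(P setT) probability_setT ltry.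
exists M; split; first exact: num_real.
by move=> y My x _ /=; rewrite (le_trans (fM x))// ltW.
Qed.

Lemma bounded_measurable_cst (c : R) : bounded_measurable (fun=> c).
Proof. by split; [exact: measurable_cst|exists `|c|]. Qed.

Lemma bounded_measurableD f g : bounded_measurable f -> bounded_measurable g ->
  bounded_measurable (fun x => f x + g x).
Proof.
move=> [mf [M fM]] [mg [N gN]]; split; first exact: measurable_funD.
by exists (M + N) => x; rewrite (le_trans (ler_normD _ _))// lerD.
Qed.

Lemma bounded_measurableM f g : bounded_measurable f -> bounded_measurable g ->
  bounded_measurable (fun x => f x * g x).
Proof.
move=> [mf [M fM]] [mg [N gN]]; split; first exact: measurable_funM.
by exists (M * N) => x; rewrite normrM ler_pM.
Qed.

Lemma expectation_linear P f g (a b : R) :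
  bounded_measurable f -> bounded_measurable g ->
  \int[P]_x (a * f x + b * g x) = a * \int[P]_x f x + b * \int[P]_x g x.
Proof.
move=> bf bg.
have iZ (c : R) h : bounded_measurable h ->
    P.-integrable setT (EFin \o (fun x => c * h x)).
  move=> bh; apply: bounded_measurable_integrable.
  by apply: bounded_measurableM => //; exact: bounded_measurable_cst.
rewrite RintegralD//; [|exact: iZ..].
by rewrite !RintegralZl//; exact: bounded_measurable_integrable.
Qed.

Lemma bounded_convergence P (f_ : nat -> T -> R) f (M : R) :
  (forall n, measurable_fun setT (f_ n)) -> (forall n x, `|f_ n x| <= M) ->
  (forall x, f_ n x @[n --> \oo] --> f x) ->
  bounded_measurable f /\ \int[P]_x f_ n x @[n --> \oo] --> \int[P]_x f x.
Proof.
move=> mf fM ff.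
have mf' : measurable_fun setT f by apply: measurable_fun_cvg => // x _; exact: ff.
have bf : bounded_measurable f.
  split => //; exists M => x.
  apply: (ler_cvg_to (cvg_norm (ff x)) (cvg_cst M)).
  by apply: nearW => n; exact: fM.
split => //.
have iM : P.-integrable setT (EFin \o (fun=> M)).
  by apply: bounded_measurable_integrable; exact: bounded_measurable_cst.
have h : (\int[P]_x (f_ n x)%:E)%E @[n --> \oo] --> (\int[P]_x (f x)%:E)%E.
  apply: (@dominated_cvg _ _ _ _ setT _ _ _ (EFin \o (fun=> M))) => //.
  - by move=> n; exact/measurable_EFinP.
  - by move=> x _; apply: cvg_EFin; [exact: nearW|exact: ff].
  - by move=> n x _; rewrite lee_fin.
apply: fine_cvg => /=.
rewrite /Rintegral fineK//; apply: integrable_fin_num => //.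
exact: bounded_measurable_integrable.
Qed.

End bounded_measurable.

Lemma bounded_measurable_comp d d' (T : measurableType d) (T' : measurableType d')
    (R : realType) (f : T' -> R) (X : T -> T') :
  measurable_fun setT X -> bounded_measurable f -> bounded_measurable (f \o X).
Proof.
move=> mX [mf [M fM]]; split; first exact: measurableT_comp.
by exists M => x; exact: fM.
Qed.

Lemma expectation_distribution d d' (T : measurableType d)
    (T' : measurableType d') (R : realType) (P : probability T R)
    (X : {RV P >-> T'}) (f : T' -> R) :
  bounded_measurable f ->
  \int[distribution P X]_y f y = \int[P]_x f (X x).
Proof.
move=> bf; rewrite /Rintegral integral_distribution//.
  by case: bf => mf _; exact/measurable_EFinP.
apply: (@bounded_measurable_integrable _ _ _ P (f \o X)).
exact: bounded_measurable_comp.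
Qed.

Lemma bounded_measurable_cos d (T : measurableType d) (R : realType) (f : T -> R) :
  measurable_fun setT f -> bounded_measurable (fun x => cos (f x)).
Proof.
move=> mf; split.
  apply: (measurableT_comp _ mf); apply: continuous_measurable_fun; exact: continuous_cos.
by exists 1 => x; rewrite ler_norml cos_geN1 cos_le1.
Qed.

(** * Borel sets of column vectors *)

Section borel_vectors.
Context (R : realType) (n : nat).
Implicit Types (a : 'I_n -> R) (U : set 'cV[R]_n).

Lemma nbhs_cVP (x : 'cV[R]_n) U :
  nbhs x U <-> exists2 e : R, 0 < e &
    [set y : 'cV[R]_n | forall i, `|x i 0 - y i 0| < e] `<=` U.
Proof.
split.
  move=> /nbhs_ballP[e e0 xU]; exists e => // y xy; apply: xU; split => // i j.
  by rewrite ord1; exact: xy.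
move=> [e e0 xU]; apply/nbhs_ballP; exists e => // y [_ xy]; apply: xU => i.
exact: xy.
Qed.

(** Second countability in explicit form: it is what makes the sigma-algebra
    generated by the open sets the one generated by the coordinates. *)
Lemma open_rational_boxes U : open U ->
  U = \bigcup_(c in [set c : 'cV[rat]_n * nat |
        [set y : 'cV[R]_n | forall i, `|ratr (c.1 i 0) - y i 0| < c.2.+1%:R^-1] `<=` U])
      [set y : 'cV[R]_n | forall i, `|ratr (c.1 i 0) - y i 0| < c.2.+1%:R^-1].
Proof.
move=> oU; apply/seteqP; split; last by move=> y [c /= cU yc]; exact: cU.
move=> x Ux.
have /nbhs_cVP[e e0 eU] : nbhs x U by exact: open_nbhs_nbhs.
have [k ke] : exists k : nat, k.+1%:R^-1 < e / 2.
  have := near_infty_natSinv_lt (PosNum (divr_gt0 e0 (ltr0n R 2))).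
  by move=> [k _ /(_ k (leqnn k))] /= ?; exists k.
have k0 : 0 < k.+1%:R^-1 :> R by rewrite invr_gt0.
have q_ i : {q : rat | `|ratr q - x i 0| < k.+1%:R^-1}.
  apply: cid.
  have : x i 0 - k.+1%:R^-1 < x i 0 + k.+1%:R^-1.
    by rewrite ltrD2l (lt_trans _ k0)// oppr_lt0.
  move=> /rat_in_itvoo[q].
  by rewrite in_itv/= => qx; exists q; rewrite ltr_distl.
exists (\col_i sval (q_ i), k); last by move=> i /=; rewrite mxE; exact: svalP (q_ i).
move=> y /= yq; apply: eU => i /=.
have := yq i; rewrite mxE => yqi; have xqi := svalP (q_ i).
rewrite (le_lt_trans (ler_distD (ratr (sval (q_ i))) _ _))//.
by rewrite distrC (splitr e) ltrD// (lt_trans _ ke).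
Qed.

Lemma continuous_measurable_cV (f : 'cV[R]_n -> R) :
  continuous f -> measurable_fun setT f.
Proof.
move=> /continuousP cf.
apply: (@measurability _ _ _ _ setT f _ (RGenOpens.measurableE R)).
move=> _ [_ [a [b ->] <-]]; rewrite setTI; apply: sub_sigma_algebra; apply: cf.
exact: interval_open.
Qed.

Lemma measurable_coord i : measurable_fun setT (fun x : 'cV[R]_n => x i 0).
Proof. by apply: continuous_measurable_cV; exact: coord_continuous. Qed.

Lemma measurable_fun_coordP d (T : measurableType d) (f : T -> 'cV[R]_n) :
  measurable_fun setT f <-> forall i, measurable_fun setT (fun x => f x i 0).
Proof.
split=> [mf i|mf].
  exact: (measurableT_comp (measurable_coord i) mf).
apply: (@measurability _ _ _ _ setT f (@open 'cV[R]_n)) => //.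
move=> _ [U oU <-]; rewrite setTI (open_rational_boxes oU) preimage_bigcup.
rewrite bigcup_mkcond; apply: countable_bigcupT_measurable => // c.
case: ifPn => // _.
rewrite (_ : _ @^-1` _ = \bigcap_(i in [set: 'I_n])
    (fun x => f x i 0) @^-1`
    [set r | `|ratr (c.1 i 0) - r| < c.2.+1%:R^-1]); last first.
  by apply/seteqP; split => [x fx i _|x fx i]; [exact: fx|exact: fx].
apply: fin_bigcap_measurable => // i _.
rewrite -[X in measurable X]setTI; apply: mf => //.
rewrite (_ : [set r | _] = `](ratr (c.1 i 0) - c.2.+1%:R^-1),
                             (ratr (c.1 i 0) + c.2.+1%:R^-1)[%classic).
  exact: measurable_itv.
by apply/seteqP; split => r /=; rewrite in_itv/= distrC ltr_distl.
Qed.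

(** The orthants form a generating pi-system whose indicators are products of
    indicators of half-spaces, the form in which trigonometric functions reach
    them below. *)
Definition orthant a : set 'cV[R]_n := [set x | forall i, a i < x i 0].

Lemma measurable_dot (t : 'cV[R]_n) :
  measurable_fun setT (fun x : 'cV[R]_n => (t^T *m x) 0 0).
Proof.
under eq_fun do rewrite mxE.
by apply: measurable_sum => i; apply: measurable_funM => //; exact: measurable_coord.
Qed.

Lemma measurable_orthant a : measurable (orthant a).
Proof.
rewrite (_ : orthant a = \bigcap_(i in [set: 'I_n])
    (fun x : 'cV[R]_n => x i 0) @^-1` `]a i, +oo[%classic); last first.
  by apply/seteqP; split => [x ax i _|x ax i] /=; have := ax i;
    rewrite /= in_itv/= andbT => h; apply: h.
apply: fin_bigcap_measurable => // i _.
by rewrite -[X in measurable X]setTI; apply: measurable_coord.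
Qed.

Lemma orthant_cover : \bigcup_k orthant (fun=> - k%:R) = setT.
Proof.
apply/seteqP; split => // x _.
have [k xk] : exists k : nat, `|x| < k%:R.
  by exists (Num.bound `|x|); rewrite archi_boundP.
exists k => // i; rewrite ltrNl (le_lt_trans _ xk)//.
rewrite (le_trans (ler_norm _))// normrN.
rewrite [leRHS]/Num.norm/= mx_normrE.
exact: (le_bigmax_cond 0
  (fun ij : 'I_n * 'I_1 => `|x ij.1 ij.2|) (j := (i, 0))).
Qed.

(** On the sigma-algebra generated by the orthants the coordinates are already
    measurable: a half-space is an increasing union of orthants whose other
    corners go to minus infinity. *)
Lemma orthant_generates : @measurable _ 'cV[R]_n = <<s range orthant >>.
Proof.
apply/seteqP; split; last first.
  by apply: smallest_sub; [exact: sigma_algebra_measurable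
    |move=> _ [a _ <-]; exact: measurable_orthant].
pose S := g_sigma_algebraType (range orthant).
suff mid : measurable_fun setT (id : S -> 'cV[R]_n).
  by move=> B mB; have := mid measurableT B mB; rewrite setTI.
apply/measurable_fun_coordP => i.
apply: (@measurability _ _ _ _ setT (fun x : S => x i 0) _ (RGenOInfty.measurableE R)).
move=> _ [_ [r ->] <-]; rewrite setTI.
rewrite (_ : _ @^-1` _ =
    \bigcup_k orthant (fun j => if j == i then r else - k%:R)).
  by apply: bigcupT_measurable => k; apply: sub_sigma_algebra; exists
    (fun j => if j == i then r else - k%:R).
apply/seteqP; split => x /=.
  rewrite in_itv/= andbT => rx.
  have : [set: 'cV[R]_n] x by [].
  rewrite -orthant_cover => -[k _ kx]; exists k => // j.
  by case: eqP => [->//|_]; exact: kx.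
by move=> [k _ /(_ i)]; rewrite eqxx in_itv/= andbT.
Qed.

Lemma orthantI : setI_closed (range orthant).
Proof.
move=> _ _ [a _ <-] [b _ <-]; exists (fun i => Num.max (a i) (b i)) => //.
apply/seteqP; split => [x abx|x [ax bx] i]; last by rewrite gt_max ax bx.
by split => i; have := abx i; rewrite gt_max => /andP[].
Qed.

Lemma orthant_measure_unique (mu nu : probability 'cV[R]_n R) :
  (forall a, mu (orthant a) = nu (orthant a)) ->
  forall B, measurable B -> mu B = nu B.
Proof.
move=> munu; apply: (measure_unique (range orthant) (fun k => orthant (fun=> - k%:R))).
- exact: orthant_generates.
- exact: orthantI.
- by move=> k; exists (fun=> - k%:R).
- exact: orthant_cover.
- by move=> _ [a _ <-]; exact: munu.
- move=> k; rewrite (le_lt_trans (probability_le1 _ _)) ?ltry//.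
  exact: measurable_orthant.
Qed.

End borel_vectors.

(** * Thresholds as limits of trigonometric polynomials *)

Section threshold.
Context (R : realType).

(** A polynomial map of [-1, 1] into itself that increases every point except
    its fixed points 0 and 1 and sends negative points to nonpositive ones. *)
Definition threshold_step (w : R) := w + w ^+ 2 * (1 - w) / 2.

Lemma threshold_step_bounds w : -1 <= w <= 1 ->
  w <= threshold_step w <= 1 /\ (w <= 0 -> threshold_step w <= 0).
Proof.
move=> /andP[w1 w2]; rewrite /threshold_step; split.
  apply/andP; split; first by rewrite lerDl divr_ge0// mulr_ge0 ?sqr_ge0// subr_ge0.
  have w21 : w ^+ 2 <= 1.
    have : 0 <= (1 - w) * (1 + w) by rewrite mulr_ge0//; lra.
    by lra.
  have : w ^+ 2 * (1 - w) <= 1 * (1 - w) by rewrite ler_wpM2r// subr_ge0.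
  by lra.
move=> w0; have -> : w + w ^+ 2 * (1 - w) / 2 = w * (1 + w * (1 - w) / 2) by ring.
rewrite mulr_le0_ge0//.
have : (1 + w) * (w - 2) <= 0 by rewrite mulr_ge0_le0//; lra.
by lra.
Qed.

(** The iterates increase to a fixed point, which is 1 when started from
    w > 0 and 0 otherwise. So the indicator of the positive reals is a bounded
    pointwise limit of polynomials on [-1, 1]. *)
Lemma iter_threshold_step_cvg w : -1 <= w <= 1 ->
  iter k threshold_step w @[k --> \oo] --> ((0 < w)%R%:R : R).
Proof.
move=> w1; have bnd k : -1 <= iter k threshold_step w <= 1.
  elim: k => // k /[dup] /andP[l u] /threshold_step_bounds[/andP[a b] _].
  by rewrite iterS b (le_trans l).
have nd : nondecreasing_seq (fun k => iter k threshold_step w).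
  by apply/nondecreasing_seqP => k; have [/andP[]] := threshold_step_bounds (bnd k).
have cv : cvgn (fun k => iter k threshold_step w).
  apply: nondecreasing_is_cvgn => //; exists 1 => _ [k _ <-].
  by have /andP[] := bnd k.
set l := limn (fun k => iter k threshold_step w) in cv *.
have fixl : threshold_step l = l.
  have shifted : iter k.+1 threshold_step w @[k --> \oo] --> l.
    by move: cv; rewrite -cvg_shiftS.
  have stepped :
      threshold_step (iter k threshold_step w) @[k --> \oo] --> threshold_step l.
    rewrite /threshold_step; apply: cvgD; first exact: cv.
    apply: cvgM; last exact: cvg_cst.
    apply: cvgM; last by apply: cvgB; [exact: cvg_cst|exact: cv].
    by under eq_fun do rewrite expr2; rewrite expr2; apply: cvgM; exact: cv.
  exact: (cvg_unique _ stepped shifted).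
have : l ^+ 2 * (1 - l) = 0.
  by move: fixl; rewrite /threshold_step; lra.
move=> /eqP; rewrite mulf_eq0 sqrf_eq0 subr_eq0 => l01.
have wl : w <= l by exact: (nondecreasing_cvgn_le nd cv 0).
suff -> : ((0 < w)%R%:R : R) = l by exact: cv.
case: ltP => w0.
  case/orP: l01 => /eqP //; move=> l0.
  by move: wl; rewrite l0 leNgt w0.
case/orP: l01 => /eqP //; move=> l1.
suff : l <= 0 by rewrite -l1 ler10.
apply: limr_le => //; apply: nearW => k.
elim: k => // k ih; rewrite iterS.
by have [_] := threshold_step_bounds (bnd k); apply.
Qed.

Lemma sin_gt0_near (y : R) : `|y| < pi -> (0 < sin y) = (0 < y).
Proof.
rewrite ltr_norml => /andP[y1 y2].
case: (ltgtP 0 y) => [y0|y0|<-].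
- by rewrite sin_gt0_pi// y0.
- apply/negbTE; rewrite -leNgt -oppr_ge0 -sinN; apply: sin_ge0_pi; lra.
- by rewrite sin0 ltxx.
Qed.

(** Stretching the sine turns its sign into the sign of its argument: together
    with the previous limit, half-line indicators are iterated bounded limits of
    trigonometric polynomials. *)
Lemma sin_gt0_cvg (y : R) :
  ((0 < sin (y / k.+1%:R))%R%:R : R) @[k --> \oo] --> ((0 < y)%R%:R : R).
Proof.
apply: cvg_near_cst.
have [N yN] : exists N : nat, `|y| / pi < N%:R.
  by exists (Num.bound (`|y| / pi)); rewrite archi_boundP// divr_ge0// pi_ge0.
exists N => // k /= Nk; rewrite sin_gt0_near; first by rewrite pmulr_lgt0 ?invr_gt0.
rewrite normrM normfV [`|k.+1%:R|]ger0_norm// ltr_pdivrMr//.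
move: yN; rewrite ltr_pdivrMr ?pi_gt0// => yN.
rewrite (lt_le_trans yN)// mulrC ler_wpM2l ?pi_ge0// ler_nat.
by rewrite (leq_trans Nk).
Qed.

End threshold.

(** * Cosine expectations determine a probability measure *)

Local Notation dot t x := ((t^T *m x) 0 0).
Section multipliers.
Context (R : realType) (n : nat) (mu nu : probability 'cV[R]_n R).
Hypothesis munu : forall (t : 'cV[R]_n) (p : R),
  \int[mu]_x cos (dot t x + p) = \int[nu]_x cos (dot t x + p).

Let wave (t : 'cV[R]_n) (p : R) (x : 'cV[R]_n) := cos (dot t x + p).

Let bounded_wave t p : bounded_measurable (wave t p).
Proof.
apply: bounded_measurable_cos; apply: measurable_funD => //.
exact: measurable_dot.
Qed.

(** Testing against all waves, and not only against the constant 1, makes this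
    class stable under multiplication by waves. *)
Definition same_waves (f : 'cV[R]_n -> R) := bounded_measurable f /\
  forall t p, \int[mu]_x (f x * wave t p x) = \int[nu]_x (f x * wave t p x).

(** Passing to multipliers turns the linear class [same_waves] into an algebra. *)
Definition multiplier (m : 'cV[R]_n -> R) := bounded_measurable m /\
  forall f, same_waves f -> same_waves (fun x => f x * m x).

Let same_waves_linear f g (a b : R) : same_waves f -> same_waves g ->
  same_waves (fun x => a * f x + b * g x).
Proof.
move=> [bf hf] [bg hg]; split.
  by apply: bounded_measurableD; apply: bounded_measurableM => //;
    exact: bounded_measurable_cst.
move=> t p.
have E x : (a * f x + b * g x) * wave t p x =
    a * (f x * wave t p x) + b * (g x * wave t p x) by ring.
under eq_Rintegral do rewrite E.
under [RHS]eq_Rintegral do rewrite E.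
by rewrite !expectation_linear ?hf ?hg//; exact: bounded_measurableM.
Qed.

Let multiplier_linear m1 m2 (a b : R) : multiplier m1 -> multiplier m2 ->
  multiplier (fun x => a * m1 x + b * m2 x).
Proof.
move=> [bm1 h1] [bm2 h2]; split.
  by apply: bounded_measurableD; apply: bounded_measurableM => //;
    exact: bounded_measurable_cst.
move=> f sf; have := same_waves_linear a b (h1 _ sf) (h2 _ sf).
by congr same_waves; apply/funext => x; ring.
Qed.

Let multiplierM m1 m2 : multiplier m1 -> multiplier m2 ->
  multiplier (fun x => m1 x * m2 x).
Proof.
move=> [bm1 h1] [bm2 h2]; split; first exact: bounded_measurableM.
move=> f sf; have := h2 _ (h1 _ sf).
by congr same_waves; apply/funext => x; rewrite mulrA.
Qed.

Let multiplier1 : multiplier (fun=> 1).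
Proof.
split; first exact: bounded_measurable_cst.
by move=> f; congr same_waves; apply/funext => x; rewrite mulr1.
Qed.

(** The product-to-sum formula: a product of two waves is a combination of
    two waves. *)
Let multiplier_wave t p : multiplier (wave t p).
Proof.
split=> // f [bf hf]; split; first exact: bounded_measurableM.
move=> t' p'.
have E x : f x * wave t p x * wave t' p' x =
    2^-1 * (f x * wave (t + t') (p + p') x) + 2^-1 * (f x * wave (t - t') (p - p') x).
  have cosDB (a b : R) : cos a * cos b = (cos (a + b) + cos (a - b)) / 2.
    by rewrite cosD cosB; lra.
  have dotD (s : 'cV[R]_n) : dot (t + s) x = dot t x + dot s x.
    by rewrite linearD/= mulmxDl mxE.
  have dotN (s : 'cV[R]_n) : dot (- s) x = - dot s x.
    by rewrite linearN/= mulNmx mxE.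
  rewrite -mulrA /wave cosDB !dotD dotN.
  have -> : dot t x + p + (dot t' x + p') = dot t x + dot t' x + (p + p') by ring.
  have -> : dot t x + p - (dot t' x + p') = dot t x - dot t' x + (p - p') by ring.
  by field.
under eq_Rintegral do rewrite E.
under [RHS]eq_Rintegral do rewrite E.
by rewrite !expectation_linear ?hf//; exact: bounded_measurableM.
Qed.

Let multiplier_lim (m_ : nat -> 'cV[R]_n -> R) m (M : R) :
  (forall k, multiplier (m_ k)) -> (forall k x, `|m_ k x| <= M) ->
  (forall x, m_ k x @[k --> \oo] --> m x) -> multiplier m.
Proof.
move=> hm mM mm; have mm_ k : measurable_fun setT (m_ k) by case: (hm k) => -[].
have [bm _] := bounded_convergence mu mm_ mM mm.
split=> // f [bf hf]; split; first exact: bounded_measurableM.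
move=> t p; have [mf [N fN]] := bf.
have bfm k : bounded_measurable (fun x => f x * m_ k x * wave t p x).
  by apply: bounded_measurableM => //; apply: bounded_measurableM => //; case: (hm k).
have fmN k x : `|f x * m_ k x * wave t p x| <= N * M * 1.
  by rewrite !normrM !ler_pM// ler_norml cos_geN1 cos_le1.
have cv x : f x * m_ k x * wave t p x @[k --> \oo] --> f x * m x * wave t p x.
  by apply: cvgM; [apply: cvgM; [exact: cvg_cst|exact: mm]|exact: cvg_cst].
have [_ +] := bounded_convergence mu (fun k => (bfm k).1) fmN cv.
have [_ +] := bounded_convergence nu (fun k => (bfm k).1) fmN cv.
under eq_fun do rewrite -((hm _).2 f (conj bf hf)).2.
by move=> cnu cmu; exact: (cvg_unique _ cmu cnu).
Qed.

Let multiplier_positive m : multiplier m -> (forall x, -1 <= m x <= 1) ->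
  multiplier (fun x => (0 < m x)%R%:R).
Proof.
move=> hm m1; apply: (@multiplier_lim (fun k x => iter k (@threshold_step R) (m x)) _ 1).
- elim=> // k ih; rewrite /= /threshold_step.
  have := multiplier_linear 1 1 ih (multiplierM (multiplierM ih ih)
    (multiplier_linear 2^-1 (- 2^-1) multiplier1 ih)).
  by congr multiplier; apply/funext => x; field.
- move=> k x; rewrite ler_norml; elim: k => [|k /[dup] /andP[l u]]; first exact: m1.
  by move=> /threshold_step_bounds[/andP[a b] _]; rewrite iterS b (le_trans l).
- by move=> x; exact: iter_threshold_step_cvg.
Qed.

(** [fun x => sin ((t.x - a) / (k + 1))] is a wave, hence a multiplier;
    let k tend to infinity in the indicator of its positivity set. *)
Let multiplier_halfspace (t : 'cV[R]_n) (a : R) :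
  multiplier (fun x : 'cV[R]_n => (a < dot t x)%R%:R).
Proof.
apply: (@multiplier_lim
  (fun k (x : 'cV[R]_n) => (0 < sin ((dot t x - a) / k.+1%:R))%R%:R) _ 1).
- move=> k; have sinE x : sin ((dot t x - a) / k.+1%:R) =
      wave (k.+1%:R^-1 *: t) (- a / k.+1%:R - pi / 2) x.
    have -> : wave (k.+1%:R^-1 *: t) (- a / k.+1%:R - pi / 2) x =
        cos (k.+1%:R^-1 * dot t x + (- a / k.+1%:R - pi / 2)).
      by rewrite /wave linearZ/= -scalemxAl mxE.
    by rewrite -cosBpihalf; congr cos; ring.
  under eq_fun do rewrite sinE.
  apply: multiplier_positive => // x; rewrite /wave cos_geN1 cos_le1//.
- by move=> k x; case: ltP => _; rewrite ?normr1 ?normr0.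
- move=> x; have := @sin_gt0_cvg R (dot t x - a).
  by rewrite subr_gt0.
Qed.

Let multiplier_orthant a : multiplier (fun x => \1_(orthant a) x).
Proof.
have -> : (fun x => \1_(orthant a) x) =
    (fun x : 'cV[R]_n => \prod_(i < n) (a i < x i 0)%R%:R) :> ('cV[R]_n -> R).
  apply/funext => x; rewrite indicE; case: (boolP (x \in orthant a)) => [|xa].
    by rewrite inE => ax; rewrite big1// => i _; rewrite ax.
  suff [i ai] : exists i, ~~ (a i < x i 0) by rewrite (bigD1 i)//= (negbTE ai) mul0r.
  apply/existsP; rewrite -negb_forall; apply: contra xa => /forallP ax.
  by rewrite inE.
have prodE (s : seq 'I_n) : multiplier (fun x => \prod_(i <- s) (a i < x i 0)%R%:R).
  elim: s => [|i s ih].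
    by under eq_fun do rewrite big_nil; exact: multiplier1.
  under eq_fun do rewrite big_cons.
  apply: multiplierM => //.
  have := multiplier_halfspace (delta_mx i 0) (a i).
  congr multiplier; apply/funext => x; congr (_ < _)%R%:R.
  by rewrite trmx_delta -rowE mxE.
exact: prodE.
Qed.

Lemma same_cos_orthant a : mu (orthant a) = nu (orthant a).
Proof.
have same1 : same_waves (fun=> 1).
  split; first exact: bounded_measurable_cst.
  move=> t p; under eq_Rintegral do rewrite mul1r.
  by under [RHS]eq_Rintegral do rewrite mul1r; exact: munu.
have [b1] := (multiplier_orthant a).2 _ same1.
move=> /(_ 0 0).
have E (x : 'cV[R]_n) : 1 * \1_(orthant a) x * wave 0 0 x = \1_(orthant a) x :> R.
  by rewrite /wave trmx0 mul0mx mxE addr0 cos0 mulr1 mul1r.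
under eq_Rintegral do rewrite E.
under [RHS]eq_Rintegral do rewrite E.
rewrite /Rintegral !integral_indic//; [|exact: measurable_orthant..].
rewrite !setIT => h.
have fin (P : probability 'cV[R]_n R) : P (orthant a) \is a fin_num.
  by apply: fin_num_measure; exact: measurable_orthant.
by rewrite -(fineK (fin mu)) h (fineK (fin nu)).
Qed.

End multipliers.

(** Uniqueness of characteristic functions, in real form (the phases p = 0 and
    p = - pi / 2 give the real and imaginary parts). The expectations of the
    waves determine those of trigonometric polynomials, then by bounded
    convergence those of indicators of half-spaces and, since the functions
    reached form an algebra, those of orthants. *)
Theorem cos_expectations_determine (R : realType) (n : nat)
    (mu nu : probability 'cV[R]_n R) :
  (forall (t : 'cV[R]_n) p,
    \int[mu]_x cos (dot t x + p) = \int[nu]_x cos (dot t x + p)) ->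
  forall B, measurable B -> mu B = nu B.
Proof.
move=> munu; apply: orthant_measure_unique => a; exact: same_cos_orthant.
Qed.

(** * Univariate normal laws *)

Section normal_law.
Context (R : realType).
Notation leb := (@lebesgue_measure R).
Implicit Types (a c e p s u x : R).

Let translate c (x : measurableTypeR R) : measurableTypeR R := c + x.

Let measurable_translate c : measurable_fun setT (translate c).
Proof. exact: measurable_funD. Qed.

HB.instance Definition _ c :=
  isMeasurableFun.Build _ _ _ _ (translate c) (measurable_translate c).

Lemma lebesgue_measure_translate c (B : set R) : measurable B ->
  pushforward leb (translate c) B = leb B.
Proof.
move=> mB; apply/esym/lebesgue_measure_unique => //= _ [[a b]] _ <-.
rewrite /pushforward (_ : _ @^-1` _ = `](a - c), (b - c)]%classic); last first.
  by apply/seteqP; split => x /=; rewrite !in_itv/= /translate ltrBlDl lerBrDl.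
rewrite !lebesgue_measure_itv/= !lte_fin ltrD2r; case: ifP => // _.
by rewrite -!EFinD; congr _%:E; ring.
Qed.

Lemma normal_prob_shift a c s (B : set R) : s != 0 -> measurable B ->
  normal_prob a s ((fun x => c + x) @^-1` B) = normal_prob (c + a) s B.
Proof.
move=> s0 mB; rewrite /normal_prob.
transitivity (\int[pushforward leb (translate c)]_(y in B)
    (normal_pdf (c + a) s y)%:E)%E; last first.
  by apply: eq_measure_integral => //= A mA _; exact: lebesgue_measure_translate.
rewrite (ge0_integral_pushforward (measurable_translate c)); first last.
- by move=> x _; rewrite lee_fin; exact: normal_pdf_ge0.
- by apply: measurable_funTS; apply/measurable_EFinP; exact: measurable_normal_pdf.
- exact: mB.
apply: eq_integral => x _; rewrite /= !normal_pdfE// /normal_fun.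
by have -> : translate c x - (c + a) = x - a by rewrite /translate; ring.
Qed.

Lemma normal_law1_shift a c (s2 : R) (B : set R) : measurable B -> 0 <= s2 ->
  normal_law1 a s2 ((fun x => c + x) @^-1` B) = normal_law1 (c + a) s2 B.
Proof.
move=> mB s20; rewrite /normal_law1; case: eqP => [_|/eqP s2n0]; first by [].
by rewrite normal_prob_shift// gt_eqF// sqrtr_gt0 lt_neqAle eq_sym s2n0.
Qed.

(** [normal_prob] is defined through its values on sets; its Radon-Nikodym
    derivative is almost everywhere the explicit density. *)
Lemma integral_normal_prob a s (f : R -> \bar R) :
  (normal_prob a s).-integrable setT f ->
  (\int[normal_prob a s]_x f x = \int[leb]_x (f x * (normal_pdf a s x)%:E))%E.
Proof.
move=> intf; have mf := measurable_int _ intf.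
rewrite -(Radon_Nikodym_change_of_variables (@normal_prob_dominates R a s))//=.
apply: ae_eq_integral => //.
- apply: emeasurable_funM => //; apply: (measurable_int leb).
  by apply: Radon_Nikodym_integrable; exact: normal_prob_dominates.
- apply: emeasurable_funM => //=; apply/measurable_EFinP; exact: measurable_normal_pdf.
- apply: ae_eqe_mul2l => /=.
  rewrite Radon_NikodymE//=; first exact: normal_prob_dominates.
  move=> dom; case: cid => /= h [h1 h2 h3].
  apply: integral_ae_eq => //=.
  + by apply/measurable_EFinP; exact: measurable_normal_pdf.
  + by move=> E _ mE; rewrite -h3.
Qed.

Lemma normal_pdf_gt0 a s x : s != 0 -> 0 < normal_pdf a s x.
Proof. by move=> s0; rewrite normal_pdfE// mulr_gt0 ?expR_gt0 ?normal_peak_gt0. Qed.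

Lemma normal_prob_itv_gt0 a s c e : s != 0 -> 0 < e ->
  (0 < normal_prob a s `](c - e)%R, (c + e)%R[%classic)%E.
Proof.
move=> s0 e0; set I := `](c - e), (c + e)[%classic.
rewrite lt0e measure_ge0 andbT; apply/eqP => PI0.
have : (\int[leb]_(x in I) `|(normal_pdf a s x)%:E| = 0)%E.
  by rewrite -PI0; apply: eq_integral => x _; rewrite /= ger0_norm ?normal_pdf_ge0.
have mI : measurable I by exact: measurable_itv.
have mphi : measurable_fun I (fun x => (normal_pdf a s x)%:E).
  by apply: measurable_funTS; apply/measurable_EFinP; exact: measurable_normal_pdf.
move=> /(ae_eq_integral_abs leb mI mphi)[N [mN N0 IN]].
have : (leb I <= leb N)%E.
  apply: le_measure; rewrite ?inE//.
  move=> x Ix; apply: IN => /(_ Ix) /= /eqP; rewrite eqe; apply/negP.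
  by rewrite gt_eqF// normal_pdf_gt0.
rewrite N0 lebesgue_measure_itv/= lte_fin.
have ce : c - e < c + e by lra.
by rewrite ce -EFinB lee_fin; apply/negP; rewrite -ltNge subr_gt0.
Qed.

(** With z = x / s, |z| <= 1 + z^2 / 4 <= exp (z^2 / 4): half of the Gaussian
    decay absorbs the linear factor, leaving a Gaussian of twice the variance. *)
Lemma norm_normal_fun_le s x : 0 < s ->
  `|x| * normal_fun 0 s x <= s * normal_fun 0 (Num.sqrt 2 * s) x.
Proof.
move=> s0; rewrite /normal_fun subr0.
set y := (`|x| / s / 2) ^+ 2.
have yE : y = x ^+ 2 / s ^+ 2 / 4.
  by rewrite /y !exprMn real_normK ?num_real//; field; rewrite gt_eqF.
have -> : - x ^+ 2 / ((Num.sqrt 2 * s) ^+ 2 *+ 2) = - y.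
  by rewrite yE exprMn sqr_sqrtr//; field; rewrite gt_eqF.
have -> : - x ^+ 2 / (s ^+ 2 *+ 2) = - y - y by rewrite yE; field; rewrite gt_eqF.
rewrite expRD mulrA ler_pM2r ?expR_gt0//.
rewrite expRN ler_pdivrMr ?expR_gt0//.
rewrite (@le_trans _ _ (s * (1 + y)))//; last by rewrite ler_pM2l// expR_ge1Dx.
have -> : `|x| = s * (2 * (`|x| / s / 2)) by field; rewrite gt_eqF.
rewrite ler_pM2l// /y; set z := `|x| / s / 2.
by have := sqr_ge0 (z - 1); lra.
Qed.

Lemma integrable_norm_normal_pdf s : 0 < s ->
  leb.-integrable setT (fun x => (`|x| * normal_pdf 0 s x)%:E).
Proof.
move=> s0; have s1 : 0 < Num.sqrt 2 * s by rewrite mulr_gt0// sqrtr_gt0.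
pose k := normal_peak s * s / normal_peak (Num.sqrt 2 * s).
apply: (@le_integrable _ _ _ leb setT measurableT _
    (fun x => (k * normal_pdf 0 (Num.sqrt 2 * s) x)%:E)).
- apply/measurable_EFinP; apply: measurable_funM; last exact: measurable_normal_pdf.
  exact: normr_measurable.
- move=> x _; rewrite /= lee_fin !normal_pdfE ?gt_eqF//.
  have k0 : 0 <= k by rewrite /k !mulr_ge0 ?invr_ge0 ?normal_peak_ge0 ?(ltW s0).
  rewrite (ger0_norm (mulr_ge0 _ (mulr_ge0 (normal_peak_ge0 _) (normal_fun_ge0 _ _ _))))//.
  rewrite (ger0_norm (mulr_ge0 k0 (mulr_ge0 (normal_peak_ge0 _) (normal_fun_ge0 _ _ _)))).
  rewrite mulrCA [leRHS]mulrA /k divfK ?gt_eqF ?normal_peak_gt0//.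
  rewrite -mulrA ler_pM2l ?norm_normal_fun_le//.
  - by rewrite normal_peak_gt0// gt_eqF.
  - by rewrite gt_eqF.
- under eq_fun do rewrite EFinM.
  by apply: integrableZl => //; exact: integrable_normal_pdf.
Qed.

End normal_law.

(** * The characteristic function of a normal law *)

Section normal_cos.
Context (R : realType) (s p : R).
Hypothesis s0 : 0 < s.
Notation leb := (@lebesgue_measure R).
Implicit Types u x : R.
Local Notation phi := (normal_pdf 0 s).

Let sN0 : s != 0. Proof. by rewrite gt_eqF. Qed.

Let is_derive_affine u x : is_derive x 1 (fun y : R => u * y + p) u.
Proof.
rewrite (_ : (fun y => _) = (u \*: (id : R -> R)) + cst p)//.
by apply: is_derive_eq; rewrite addr0 /GRing.scale/= mulr1.
Qed.

Let is_derive_phi x : is_derive x 1 phi (- (x / s ^+ 2) * phi x).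
Proof.
rewrite normal_pdfE//.
rewrite (_ : (fun y => _) = normal_peak s \*:
    (expR \o ((- (s ^+ 2 *+ 2)^-1) \*: ((id : R -> R) ^+ 2)))); last first.
  apply/funext => y; rewrite /normal_fun /= subr0 /GRing.scale/=; congr (_ * expR _).
  by rewrite fctE; field.
apply: is_derive_eq; rewrite /normal_fun /= subr0 /GRing.scale/= fctE expr1.
have -> : - (s ^+ 2 *+ 2)^-1 * x ^+ 2 = - x ^+ 2 / (s ^+ 2 *+ 2) by field.
by field.
Qed.

Let cos_phi u x := cos (u * x + p) * phi x.
Let sin_phi u x := sin (u * x + p) * phi x.

Let is_derive_sin_phi u x :
  is_derive x 1 (sin_phi u) (u * cos_phi u x - (x / s ^+ 2) * sin_phi u x).
Proof.
apply: (is_derive_eq (is_deriveM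
  (is_derive1_comp (is_derive_sin _) (is_derive_affine u x)) (is_derive_phi x))).
rewrite /GRing.scale/= /cos_phi /sin_phi; ring.
Qed.

Let is_derive_cos_phi u x :
  is_derive u 1 (fun v => cos_phi v x) (- (x * sin_phi u x)).
Proof.
have dE : (fun v => cos_phi v x) = phi x \*: (cos \o (fun v : R => x * v + p)).
  by apply/funext => v; rewrite /cos_phi [v * x]mulrC; exact: mulrC.
rewrite dE; apply: (is_derive_eq (is_deriveZ (phi x)
  (is_derive1_comp (is_derive_cos _) (is_derive_affine x u)))).
rewrite /GRing.scale/= /sin_phi [u * x]mulrC; ring.
Qed.

Let measurable_phi : measurable_fun setT phi.
Proof. exact: measurable_normal_pdf. Qed.

Let measurable_affine u : measurable_fun setT (fun x => u * x + p).
Proof. by apply: measurable_funD => //; exact: measurable_funM. Qed.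

Let measurable_cos_phi u : measurable_fun setT (cos_phi u).
Proof.
apply: measurable_funM => //; apply: (measurableT_comp _ (measurable_affine u)).
by apply: continuous_measurable_fun; exact: continuous_cos.
Qed.

Let measurable_sin_phi u : measurable_fun setT (sin_phi u).
Proof.
apply: measurable_funM => //; apply: (measurableT_comp _ (measurable_affine u)).
by apply: continuous_measurable_fun; exact: continuous_sin.
Qed.

Let integrable_cos_phi u : leb.-integrable setT (fun x => (cos_phi u x)%:E).
Proof.
apply: le_integrable (integrable_normal_pdf 0 s) => //.
  by apply/measurable_EFinP; exact: measurable_cos_phi.
move=> x _; rewrite lee_fin normrM ler_piMl//.
by rewrite ler_norml cos_geN1 cos_le1.
Qed.

Let integrable_x_sin_phi u : leb.-integrable setT (fun x => (x * sin_phi u x)%:E).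
Proof.
apply: le_integrable (integrable_norm_normal_pdf s0) => //.
  by apply/measurable_EFinP; apply: measurable_funM => //; exact: measurable_sin_phi.
move=> x _; rewrite lee_fin !normrM normr_id ler_wpM2l// ler_piMl//.
by rewrite ler_norml sin_geN1 sin_le1.
Qed.

Let sin_phi_cvg0 u :
  sin_phi u n.+1%:R - sin_phi u (- n.+1%:R) @[n --> \oo] --> (0 : R).
Proof.
pose k := normal_peak s * s.
have bnd x : 1 <= `|x| -> `|sin_phi u x| <= k / `|x|.
  move=> x1; have x0 : 0 < `|x| by rewrite (lt_le_trans _ x1).
  have sinphi : `|sin_phi u x| <= phi x.
    rewrite /sin_phi normrM (ger0_norm (normal_pdf_ge0 _ _ _)).
    by rewrite ler_piMl ?normal_pdf_ge0// ler_norml sin_geN1 sin_le1.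
  rewrite ler_pdivlMr// (le_trans (ler_wpM2r (ltW x0) sinphi))//.
  rewrite normal_pdfE// -mulrA /k ler_pM2l ?normal_peak_gt0// mulrC.
  rewrite (le_trans (norm_normal_fun_le x s0))// ler_piMr ?(ltW s0)//.
  rewrite /normal_fun -[leRHS]expR0 ler_expR mulNr oppr_le0.
  by rewrite divr_ge0 ?sqr_ge0// mulrn_wge0// sqr_ge0.
apply: norm_cvg0.
apply: (@squeeze_cvgr _ _ _ _ (cst 0) (fun n : nat => (2 * k) * n.+1%:R^-1)).
- apply: nearW => n; rewrite normr_ge0/=.
  have n1 : 1 <= `|n.+1%:R : R| by rewrite ger0_norm// ler1n.
  rewrite (le_trans (ler_normB _ _))//.
  have := bnd _ n1; have := bnd (- n.+1%:R); rewrite normrN => /(_ n1).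
  by rewrite [`|n.+1%:R|]ger0_norm//; set q := n.+1%:R^-1; lra.
- exact: cvg_cst.
- by rewrite -(mulr0 (2 * k)); apply: cvgM; [exact: cvg_cst|exact: cvg_harmonic].
Qed.

(** The derivative of x |-> sin (u x + p) phi x integrates to 0 over the line,
    because this function vanishes at infinity. *)
Let integral_by_parts u :
  \int[leb]_x (x * sin_phi u x) = u * s ^+ 2 * \int[leb]_x cos_phi u x.
Proof.
pose h x := u * cos_phi u x - (x / s ^+ 2) * sin_phi u x.
pose h_ n x := (h x * \1_(`[- n.+1%:R, n.+1%:R]) x).
have hE x : h x = u * cos_phi u x + (- s ^- 2) * (x * sin_phi u x) by rewrite /h; field.
have ih1 : leb.-integrable setT (fun x => (u * cos_phi u x)%:E).
  by under eq_fun do rewrite EFinM; apply: integrableZl.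
have ih2 : leb.-integrable setT (fun x => (- s ^- 2 * (x * sin_phi u x))%:E).
  by under eq_fun do rewrite EFinM; apply: integrableZl.
have ih : leb.-integrable setT (fun x => (h x)%:E).
  by under eq_fun do rewrite hE EFinD; apply: integrableD.
have mh : measurable_fun setT h by have /measurable_EFinP := measurable_int _ ih.
have derivable_cont (F : R -> R) : (forall x, derivable F x 1) -> continuous F.
  by move=> dF x; apply/differentiable_continuous/derivable1_diffP.
have caff : continuous (fun x => u * x + p).
  by apply: derivable_cont => x; by case: (is_derive_affine u x).
have csin : continuous (sin_phi u).
  by apply: derivable_cont => x; by case: (is_derive_sin_phi u x).
have ccos : continuous (cos_phi u).
  move=> x; apply: cvgM; last exact: continuous_normal_pdf.
  by apply: (continuous_comp (caff x)); exact: continuous_cos.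
have ch : continuous h.
  move=> x; apply: cvgB; first by apply: cvgM; [exact: cvg_cst|exact: ccos].
  by apply: cvgM; [apply: cvgM; [exact: cvg_id|exact: cvg_cst]|exact: csin].
have int_h_ n : (\int[leb]_x (h_ n x)%:E)%E =
    (sin_phi u n.+1%:R - sin_phi u (- n.+1%:R))%:E.
  rewrite EFinB -(@continuous_FTC2 R h).
  - rewrite [RHS]integral_mkcond; apply: eq_integral => x _.
    by rewrite /h_ patchE indicE; case: ifPn => _; rewrite ?mulr1 ?mulr0.
  - by rewrite (lt_trans (y := 0))// oppr_lt0.
  - exact: continuous_subspaceT.
  - split; first by move=> x _; by case: (is_derive_sin_phi u x).
    + by apply: cvg_at_right_filter; exact: csin.
    + by apply: cvg_at_left_filter; exact: csin.
  - move=> x _; rewrite derive1E.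
    by case: (is_derive_sin_phi u x).
have cvg1 : (\int[leb]_x (h_ n x)%:E)%E @[n --> \oo] --> (\int[leb]_x (h x)%:E)%E.
  apply: (@dominated_cvg _ (measurableTypeR R) R leb setT measurableT
    (fun n x => (h_ n x)%:E) (fun x => (h x)%:E) (fun x => `|(h x)%:E|%E)) => //.
  - by move=> n; apply/measurable_EFinP; apply: measurable_funM => //;
      apply: measurable_indic; exact: measurable_itv.
  - move=> x _; apply: cvg_EFin; first exact: nearW.
    apply: cvg_near_cst; exists (Num.bound `|x|) => // n /= xn.
    rewrite /h_ indicE mem_set ?mulr1//= in_itv/= -ler_norml.
    rewrite (le_trans (ltW (archi_boundP (normr_ge0 x))))// ler_nat.
    by rewrite (leq_trans xn).
  - exact: integrable_abse.
  - move=> n x _; rewrite /h_ lee_fin normrM ler_piMr//.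
    by rewrite indicE; case: (_ \in _); rewrite ?normr1 ?normr0.
have h0 : (\int[leb]_x (h x)%:E = 0)%E.
  move: cvg1; rewrite (funext int_h_) => cvg1; apply: (cvg_unique _ cvg1) => //.
  by apply: cvg_EFin; [exact: nearW|exact: sin_phi_cvg0].
have : \int[leb]_x h x = 0 by rewrite /Rintegral h0.
under eq_Rintegral do rewrite hE.
rewrite RintegralD//; rewrite !RintegralZl//;
  [|exact: integrable_x_sin_phi|exact: integrable_cos_phi].
have : s ^+ 2 != 0 by rewrite sqrf_eq0.
move=> s2 /eqP; rewrite mulNr subr_eq0 => /eqP E.
by rewrite mulrAC E; field.
Qed.

Let C u := \int[leb]_x cos_phi u x.

(** Differentiation under the integral sign followed by integration by parts
    gives the equation C' u = - s^2 u C u, solved by exp (- s^2 u^2 / 2). *)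
Let is_derive_C u : is_derive u 1 C (- (u * s ^+ 2) * C u).
Proof.
have Iu : [set` `](u - 1), (u + 1)[] u by rewrite /= in_itv/= ltrBlDr ltrDl ltr01.
have dE v x : partial1of2 cos_phi v x = - (x * sin_phi v x).
  by rewrite partial1of2E; case: (is_derive_cos_phi v x).
have dv v x : derivable (cos_phi ^~ x) v 1 by case: (is_derive_cos_phi v x).
have bnd v x : `|partial1of2 cos_phi v x| <= `|x| * phi x.
  rewrite dE normrN normrM ler_wpM2l// /sin_phi normrM.
  rewrite [`|phi x|]ger0_norm ?normal_pdf_ge0// ler_piMl ?normal_pdf_ge0//.
  by rewrite ler_norml sin_geN1 sin_le1.
have G0 x : 0 <= `|x| * phi x by rewrite mulr_ge0 ?normal_pdf_ge0.
have iG := integrable_norm_normal_pdf s0.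
have ider := @derivable_under_integral R _ _ leb cos_phi setT measurableT u _ _ Iu
  (fun v _ => integrable_cos_phi v) (fun v x _ _ => dv v x) _ G0 iG (fun v x _ _ => bnd v x).
have eder := @differentiation_under_integral R _ _ leb cos_phi setT measurableT u _ _ Iu
  (fun v _ => integrable_cos_phi v) (fun v x _ _ => dv v x) _ G0 iG (fun v x _ _ => bnd v x).
apply: DeriveDef; first exact: ider.
rewrite -derive1E eder; under eq_Rintegral do rewrite dE.
rewrite (_ : (fun x => _) = (fun x => (-1) * (x * sin_phi u x))); last first.
  by apply/funext => x; rewrite mulN1r.
rewrite RintegralZl//; first by rewrite integral_by_parts /C; ring.
exact: integrable_x_sin_phi.
Qed.

(** Solving the equation from C 0 = cos p to C 1 gives the characteristic function
    of the centred normal law at 1, with a phase p. *)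
Lemma normal_cos : \int[normal_prob 0 s]_x cos (x + p) = cos p * expR (- (s ^+ 2 / 2)).
Proof.
have CE u : C u * expR (s ^+ 2 / 2 * u ^+ 2) = C 0 * expR (s ^+ 2 / 2 * 0 ^+ 2).
  pose e u : R := expR (s ^+ 2 / 2 * u ^+ 2).
  have de (v : R) : is_derive v (1 : R) e (s ^+ 2 * v * e v).
    have dq : is_derive v 1 (fun w : R => s ^+ 2 / 2 * w ^+ 2) (s ^+ 2 * v).
      apply: (is_derive_eq (is_deriveZ (s ^+ 2 / 2) (is_deriveX 2 (is_derive_id _ _)))).
      by rewrite /GRing.scale/= expr1; field.
    apply: (is_derive_eq (is_derive1_comp (is_derive_expR _) dq)).
    by rewrite /e mulrC.
  apply: (@is_derive_0_is_cst R (C * e)) => v.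
  apply: (is_derive_eq (is_deriveM (is_derive_C v) (de v))).
  by rewrite /GRing.scale/=; ring.
have C0 : C 0 = cos p.
  rewrite /C; under eq_Rintegral do rewrite /cos_phi mul0r add0r.
  rewrite RintegralZl//; last exact: integrable_normal_pdf.
  by rewrite /Rintegral integral_normal_pdf mulr1.
have C1 : \int[normal_prob 0 s]_x cos (x + p) = C 1.
  rewrite /Rintegral integral_normal_prob//.
    by congr fine; apply: eq_integral => x _; rewrite /cos_phi mul1r EFinM.
  apply: (@bounded_measurable_integrable _ _ _ (normal_prob 0 s)).
  by apply: bounded_measurable_cos; exact: measurable_funD.
have := CE 1; rewrite C1 C0 expr1n mulr1 expr0n mulr0 expR0 mulr1 => <-.
by rewrite -mulrA -expRD subrr expR0 mulr1.
Qed.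

End normal_cos.

(** * Gaussian vectors *)

(** A named form of the functionals used in the definition of Gaussian measures,
    so that it can carry the structure of a measurable function. *)
Definition inner (R : realType) (n : nat) (t x : 'cV[R]_n) : R := (t^T *m x) 0 0.

HB.instance Definition _ (R : realType) (n : nat) (t : 'cV[R]_n) :=
  isMeasurableFun.Build _ _ _ _ (inner t) (measurable_dot t).

Lemma measurable_usubmx (R : realType) (m d : nat) :
  measurable_fun setT (@usubmx R m d 1).
Proof.
apply/measurable_fun_coordP => i; under eq_fun do rewrite mxE.
exact: measurable_coord.
Qed.

Lemma measurable_dsubmx (R : realType) (m d : nat) :
  measurable_fun setT (@dsubmx R m d 1).
Proof.
apply/measurable_fun_coordP => i; under eq_fun do rewrite mxE.
exact: measurable_coord.
Qed.

HB.instance Definition _ (R : realType) (m d : nat) :=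
  isMeasurableFun.Build _ _ _ _ (@usubmx R m d 1) (@measurable_usubmx R m d).

HB.instance Definition _ (R : realType) (m d : nat) :=
  isMeasurableFun.Build _ _ _ _ (@dsubmx R m d 1) (@measurable_dsubmx R m d).

Definition stack (R : realType) (m d : nat) (z : 'cV[R]_m * 'cV[R]_d) : 'cV[R]_(m + d) :=
  col_mx z.1 z.2.

Lemma measurable_stack (R : realType) (m d : nat) :
  measurable_fun setT (@stack R m d).
Proof.
apply/measurable_fun_coordP => i; rewrite /stack.
case: (split_ordP i) => j ->.
  under eq_fun do rewrite col_mxEu.
  exact: (measurableT_comp (measurable_coord j) measurable_fst).
under eq_fun do rewrite col_mxEd.
exact: (measurableT_comp (measurable_coord j) measurable_snd).
Qed.

HB.instance Definition _ (R : realType) (m d : nat) :=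
  isMeasurableFun.Build _ _ _ _ (@stack R m d) (@measurable_stack R m d).

Section gaussian_vectors.
Context (R : realType).

(** Only the law of t.x matters: a normal law, or a Dirac mass if the variance
    t^T S t vanishes. *)
Lemma gaussian_cos (n : nat) (mu : probability 'cV[R]_n R) (S : 'M[R]_n)
    (t : 'cV[R]_n) (p : R) : gaussian mu 0 S ->
  \int[mu]_x cos (inner t x + p) = cos p * expR (- ((t^T *m S *m t) 0 0 / 2)).
Proof.
move=> [[_ S0] gS]; set v := (t^T *m S *m t) 0 0.
have v0 : 0 <= v by exact: S0.
have bcos : bounded_measurable (fun y : R => cos (y + p)).
  by apply: bounded_measurable_cos; exact: measurable_funD.
have -> : \int[mu]_x cos (inner t x + p) =
    \int[distribution mu (inner t : {RV mu >-> R})]_y cos (y + p).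
  by rewrite (expectation_distribution _ bcos).
have law (B : set R) : measurable B ->
    distribution mu (inner t : {RV mu >-> R}) B = normal_law1 0 v B.
  by move=> mB; have := gS t B mB; rewrite mulmx0 mxE.
have mcos : measurable_fun setT (fun y : R => (cos (y + p))%:E).
  by case: bcos => ? _; exact/measurable_EFinP.
move: law; rewrite /normal_law1; case: eqP => [v_eq0 law|/eqP vN0 law].
  rewrite /Rintegral (@eq_measure_integral _ _ _ _ (@dirac _ R 0 R)); last first.
    by move=> A mA _; exact: law.
  by rewrite integral_dirac// diracT mul1e /= add0r v_eq0 mul0r oppr0 expR0 mulr1.
have sv : 0 < Num.sqrt v by rewrite sqrtr_gt0 lt_neqAle eq_sym vN0.
(* [normal_prob] is a measure on [measurableTypeR R], whose display is not that
   of [R], so [inner t] has to be seen as a map into that type. *)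
have mt : @measurable_fun _ _ 'cV[R]_n (measurableTypeR R) setT (inner t).
  by move=> _ B mB; exact: measurable_dot.
pose X : {RV mu >-> measurableTypeR R} :=
  @mfun_Sub _ _ 'cV[R]_n (measurableTypeR R) (inner t) (mem_set mt).
have bcos' : bounded_measurable (fun y : measurableTypeR R => cos (y + p)).
  by apply: bounded_measurable_cos; exact: measurable_funD.
rewrite (@expectation_distribution _ _ _ _ _ mu (inner t) _ bcos).
rewrite -[LHS](@expectation_distribution _ _ _ _ _ mu X _ bcos').
rewrite -[in RHS](sqr_sqrtr v0) -(normal_cos p sv); congr fine.
by apply: eq_measure_integral => A mA _; exact: law.
Qed.

Lemma covariance_matrix1 (n : nat) : covariance_matrix (1%:M : 'M[R]_n).
Proof.
split; first by rewrite trmx1.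
by move=> t; rewrite mulmx1 mxE sumr_ge0// => i _; rewrite mxE -expr2 sqr_ge0.
Qed.

Lemma covariance_matrix_congruence (n k : nat) (B : 'M[R]_(n, k)) (S : 'M[R]_k) :
  covariance_matrix S -> covariance_matrix (B *m S *m B^T).
Proof.
move=> [ST S0]; split; first by rewrite !trmx_mul trmxK ST mulmxA.
move=> t; have := S0 (B^T *m t).
by rewrite trmx_mul trmxK !mulmxA.
Qed.

Lemma gaussian_affine_image d (T : measurableType d) (P : probability T R)
    (n k : nat) (Q : {RV P >-> 'cV[R]_k}) (z : 'cV[R]_k) (S : 'M[R]_k)
    (x : 'cV[R]_n) (B : 'M[R]_(n, k)) :
  gaussian (distribution P Q) z S ->
  gaussian (distribution P (affine_map x B \o Q : {RV P >-> 'cV[R]_n}))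
    (x + B *m z) (B *m S *m B^T).
Proof.
move=> [covS gQ]; split; first exact: covariance_matrix_congruence.
move=> t C mC; set s := B^T *m t.
have sT : s^T = t^T *m B by rewrite /s trmx_mul trmxK.
transitivity (distribution P Q ((fun y => (s^T *m y) 0 0) @^-1`
    ((fun r => (t^T *m x) 0 0 + r) @^-1` C))).
  congr (P _); apply/funext => w; congr (C _).
  by rewrite /= /affine_map mulmxDr mxE mulmxA sT.
have mC' : measurable ((fun r => (t^T *m x) 0 0 + r) @^-1` C).
  by rewrite -[X in measurable X]setTI; apply: measurable_funD.
rewrite [LHS](gQ s _ mC') (normal_law1_shift _ _ mC (covS.2 s)) sT.
have -> : (t^T *m (x + B *m z)) 0 0 = (t^T *m x) 0 0 + (t^T *m B *m z) 0 0.
  by rewrite mulmxDr mxE mulmxA.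
by rewrite /s !mulmxA.
Qed.

Lemma gaussian_usubmx (m d : nat) (mu : probability 'cV[R]_(m + d) R) :
  gaussian mu 0 1%:M ->
  gaussian (distribution mu (@usubmx R m d 1 : {RV mu >-> 'cV[R]_m})) 0 1%:M.
Proof.
move=> [_ g]; split; first exact: covariance_matrix1.
move=> t B mB; have := g (col_mx t 0) B mB.
rewrite !mulmx0 !mulmx1 tr_col_mx mul_row_col trmx0 mulmx0 addr0 !mxE => <-.
congr (mu _); apply/funext => z; congr (B (_ 0 0)).
by rewrite -[X in row_mx _ _ *m X](vsubmxK z) mul_row_col mul0mx addr0.
Qed.

Lemma gaussian_dsubmx (m d : nat) (mu : probability 'cV[R]_(m + d) R) :
  gaussian mu 0 1%:M ->
  gaussian (distribution mu (@dsubmx R m d 1 : {RV mu >-> 'cV[R]_d})) 0 1%:M.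
Proof.
move=> [_ g]; split; first exact: covariance_matrix1.
move=> t B mB; have := g (col_mx 0 t) B mB.
rewrite !mulmx0 !mulmx1 tr_col_mx mul_row_col trmx0 mul0mx add0r !mxE => <-.
congr (mu _); apply/funext => z; congr (B (_ 0 0)).
by rewrite -[X in row_mx _ _ *m X](vsubmxK z) mul_row_col mul0mx add0r.
Qed.

(** Independence of the blocks of a standard Gaussian vector. Both sides have
    the same expectations of cosines: on the right, Fubini applies, the inner
    integral treats the contribution of the first block as a phase, and the two
    factors exp (- |t_i|^2 / 2) multiply to exp (- |t|^2 / 2). *)
Lemma standard_gaussian_blocks (m d : nat) (mu : probability 'cV[R]_(m + d) R)
    (mu1 : probability 'cV[R]_m R) (mu2 : probability 'cV[R]_d R) :
  gaussian mu 0 1%:M -> gaussian mu1 0 1%:M -> gaussian mu2 0 1%:M ->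
  forall D, measurable D -> mu D = (mu1 \x mu2)%E (@stack R m d @^-1` D).
Proof.
move=> g g1 g2 D mD.
transitivity (distribution (mu1 \x mu2)%E (@stack R m d : {RV (mu1 \x mu2)%E >-> _}) D) => //.
apply: cos_expectations_determine => // t p.
rewrite (@gaussian_cos _ mu _ t p g).
have bcos n (s : 'cV[R]_n) (q : R) : bounded_measurable (fun x => cos (inner s x + q)).
  by apply: bounded_measurable_cos; apply: measurable_funD.
rewrite (@expectation_distribution _ _ _ _ _ _ _ (fun x => cos (inner t x + p)))//.
set t1 := usubmx t; set t2 := dsubmx t.
set e2 := expR (- ((t2^T *m 1%:M *m t2) 0 0 / 2)).
set e1 := expR (- ((t1^T *m 1%:M *m t1) 0 0 / 2)).
have innerE z : inner t (stack z) = inner t2 z.2 + inner t1 z.1.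
  by rewrite /inner /stack -(vsubmxK t) tr_col_mx mul_row_col mxE addrC.
have bst : bounded_measurable (fun z : 'cV[R]_m * 'cV[R]_d => cos (inner t (stack z) + p)).
  exact: (bounded_measurable_comp (@measurable_stack R m d) (bcos _ t p)).
have ist := bounded_measurable_integrable (mu1 \x mu2)%E bst.
rewrite [RHS]/Rintegral -integral12_prod_meas1//.
have inner2 z1 : (\int[mu2]_z2 (cos (inner t (stack (z1, z2)) + p))%:E)%E =
    (e2 * cos (inner t1 z1 + p))%:E.
  under eq_integral do rewrite innerE -addrA.
  have := @gaussian_cos _ mu2 _ t2 (inner t1 z1 + p) g2.
  rewrite /Rintegral mulrC => <-; rewrite fineK//.
  apply: integrable_fin_num => //.
  exact: (bounded_measurable_integrable mu2 (bcos _ _ _)).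
rewrite (eq_integral (fun z1 => (e2 * cos (inner t1 z1 + p))%:E)); last first.
  by move=> z1 _; exact: inner2.
have : \int[mu1]_z1 (e2 * cos (inner t1 z1 + p)) = e2 * (cos p * e1).
  rewrite RintegralZl//; first by rewrite (gaussian_cos _ _ g1).
  exact: (bounded_measurable_integrable mu1 (bcos _ _ _)).
rewrite /Rintegral => ->.
rewrite mulrCA; congr (_ * _); rewrite /e1 /e2 -expRD; congr expR.
rewrite -mulmxA !mulmx1 !mul1mx -(vsubmxK t) tr_col_mx mul_row_col mxE.
by rewrite /t1 /t2; field.
Qed.

End gaussian_vectors.

Lemma measurable_box (R : realType) (n : nat) (b : 'cV[R]_n) (e : R) :
  measurable [set x : 'cV[R]_n | forall i, `|b i 0 - x i 0| < e].
Proof.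
rewrite (_ : [set x | _] = \bigcap_(i in [set: 'I_n]) (fun x : 'cV[R]_n => x i 0) @^-1`
  `](b i 0 - e), (b i 0 + e)[%classic); last first.
  apply/seteqP; split => [x bx i _|x bx i] /=.
    by have := bx i; rewrite /= in_itv/= distrC ltr_distl.
  by have := bx i I; rewrite /= in_itv/= distrC ltr_distl.
apply: fin_bigcap_measurable => // i _.
by rewrite -[X in measurable X]setTI; apply: measurable_coord => //; exact: measurable_itv.
Qed.

(** By induction on the dimension: independence splits the box into an interval
    for the first coordinate and a box for the remaining ones. *)
Lemma standard_gaussian_box_gt0 (R : realType) (n : nat) (mu : probability 'cV[R]_n R)
    (a : 'cV[R]_n) (e : R) : gaussian mu 0 1%:M -> 0 < e ->
  (0 < mu [set x : 'cV[R]_n | forall i, `|a i 0%R - x i 0%R| < e]%R)%E.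
Proof.
move=> + e0; elim: n mu a => [|n ih] mu a g.
  rewrite (_ : [set x | _] = setT) ?probability_setT//.
  by apply/seteqP; split => // x _ [].
rewrite -[n.+1]/(1 + n)%N in mu a g *.
pose mu1 : probability 'cV[R]_1 R := distribution mu (@usubmx R 1 n 1 : {RV mu >-> 'cV[R]_1}).
pose mu2 : probability 'cV[R]_n R := distribution mu (@dsubmx R 1 n 1 : {RV mu >-> 'cV[R]_n}).
have g1 : gaussian mu1 0 1%:M by exact: gaussian_usubmx.
have g2 : gaussian mu2 0 1%:M by exact: gaussian_dsubmx.
have mbox k (b : 'cV[R]_k) := measurable_box b e.
rewrite (standard_gaussian_blocks g g1 g2) //.
rewrite (_ : _ @^-1` _ = [set x : 'cV[R]_1 | forall i, `|usubmx a i 0 - x i 0| < e] `*`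
    [set x : 'cV[R]_n | forall i, `|dsubmx a i 0 - x i 0| < e]); last first.
  apply/seteqP; split => [[x y] /= axy|[x y] [/= ax ay] i].
    split=> i; first by have := axy (lshift n i); rewrite /stack col_mxEu mxE.
    by have := axy (rshift 1 i); rewrite /stack col_mxEd mxE.
  rewrite /stack /=; case: (split_ordP i) => j ->.
    by rewrite col_mxEu; have := ax j; rewrite mxE.
  by rewrite col_mxEd; have := ay j; rewrite mxE.
rewrite product_measure1E; [|exact: mbox..].
apply: mule_gt0; last exact: ih.
set c := usubmx a 0 0.
have := g1.2 1%:M `](c - e), (c + e)[%classic (measurable_itv _).
rewrite (_ : _ @^-1` _ = [set x : 'cV[R]_1 | forall i, `|usubmx a i 0 - x i 0| < e]).
  move=> ->; rewrite trmx1 !mul1mx !mxE /normal_law1 eqxx oner_eq0 sqrtr1.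
  by apply: normal_prob_itv_gt0 => //; exact: oner_neq0.
apply/seteqP; split => x /=; rewrite trmx1 mul1mx in_itv/= -ltr_distl distrC.
  by move=> h i; rewrite (ord1 i).
by move=> /(_ 0).
Qed.

(** * Conditioning an affine function of a Gaussian vector *)

(** Convergence theorems for integrals concern sequences; in a space of vectors
    they are enough to test continuity. *)
Lemma continuous_of_sequences (R : realType) (k : nat) (F : 'cV[R]_k -> R) y :
  (forall u : nat -> 'cV[R]_k, u n @[n --> \oo] --> y -> F (u n) @[n --> \oo] --> F y) ->
  {for y, continuous F}.
Proof.
move=> hF; apply/(@cvgrPdist_lt R R 'cV[R]_k (nbhs y) (nbhs_filter y) F (F y)) => e e0.
apply: contrapT => H.
have /choice[u hu] : forall n : nat, exists u, ball y n.+1%:R^-1 u /\ ~ (`|F y - F u| < e).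
  move=> n; apply: contrapT => Hn; apply: H.
  have := @nbhsx_ballx R 'cV[R]_k y n.+1%:R^-1 ltac:(by rewrite invr_gt0).
  by apply: filterS => z yz; apply: contrapT => Hz; apply: Hn; exists z.
have uy : u n @[n --> \oo] --> y.
  apply/cvg_ballP => e' e'0; near=> n.
  apply: (@le_ball _ _ _ n.+1%:R^-1); last exact: (hu n).1.
  by apply: ltW; near: n; exact: near_infty_natSinv_lt (PosNum e'0).
have /cvgrPdist_lt/(_ _ e0)[N _ hN] := hF u uy.
exact: (hu N).2 (hN N (leqnn N)).
Unshelve. all: by end_near. Qed.

Section affine_kernel.
Context (R : realType) d (T : measurableType d) (P : probability T R).
Context (m k n : nat) (x : 'cV[R]_n) (B1 : 'M[R]_(n, m)) (B2 : 'M[R]_(n, k)).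
Variable Z : {RV P >-> 'cV[R]_k}.

Definition affine_kernel (y : 'cV[R]_m) : {measure set 'cV[R]_n -> \bar R} :=
  distribution P (affine_map (x + B1 *m y) B2 \o Z : {RV P >-> 'cV[R]_n}).

Let joint (yz : 'cV[R]_m * 'cV[R]_k) : 'cV[R]_n :=
  affine_map x (row_mx B1 B2) (stack yz).

Let jointE y z : affine_map (x + B1 *m y) B2 z = joint (y, z).
Proof. by rewrite /joint /affine_map /stack mul_row_col addrA. Qed.

Let measurable_joint : measurable_fun setT joint.
Proof.
exact: (measurableT_comp (measurable_funPT (affine_map x (row_mx B1 B2)))
  (@measurable_stack R m k)).
Qed.

(** Written as the measure of a section of a measurable set, the kernel is
    measurable in y by the measurability of sections of product measures. *)
Lemma affine_kernel_xsection y (U : set 'cV[R]_n) :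
  affine_kernel y U = distribution P Z (xsection (joint @^-1` U) y).
Proof.
congr (P _); apply/seteqP; split => w /=.
  by rewrite jointE => h; apply/xsectionP.
by move/xsectionP => /=; rewrite jointE.
Qed.

Let affine_kernel_measurable (U : set 'cV[R]_n) : measurable U ->
  measurable_fun setT (affine_kernel ^~ U).
Proof.
move=> mU; under eq_fun do rewrite affine_kernel_xsection.
apply: (measurable_fun_xsection (distribution P Z)).
by rewrite -[X in measurable X]setTI; exact: measurable_joint.
Qed.

HB.instance Definition _ := isKernel.Build _ _ _ _ R affine_kernel affine_kernel_measurable.

Let affine_kernel_setT y : affine_kernel y setT = 1%E.
Proof. exact: probability_setT. Qed.

HB.instance Definition _ :=
  Kernel_isProbability.Build _ _ _ _ R affine_kernel affine_kernel_setT.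

Lemma affine_kernel_weakly_continuous : weakly_continuous affine_kernel.
Proof.
move=> f cf [M fM] y; apply: continuous_of_sequences => u uy.
have bf : bounded_measurable f by split; [exact: continuous_measurable_cV|exists M].
have fE z : \int[affine_kernel z]_w f w = \int[P]_w f (joint (z, Z w)).
  rewrite (@expectation_distribution _ _ _ _ _ P
    (affine_map (x + B1 *m z) B2 \o Z : {RV P >-> 'cV[R]_n}) f bf).
  by apply: eq_Rintegral => w _; rewrite -jointE.
rewrite fE; under eq_fun do rewrite fE.
apply: (bounded_convergence P (M := M) _ _ _).2 => [j|j w|w].
- apply: (measurableT_comp bf.1); apply: (measurableT_comp measurable_joint).
  exact: (measurable_fun_pair (measurable_cst _) (measurable_funPT Z)).
- exact: fM.
- rewrite -jointE; under eq_fun do rewrite -jointE.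
  have By : B1 *m u j @[j --> \oo] --> B1 *m y.
    exact: (cvg_comp _ _ uy (@continuous_mulmx R n m B1 y)).
  have hy : (x + B1 *m u j) + B2 *m Z w @[j --> \oo] --> (x + B1 *m y) + B2 *m Z w.
    by apply: cvgD; [apply: cvgD; [exact: cvg_cst|exact: By]|exact: cvg_cst].
  exact: (cvg_comp _ _ hy (cf _)).
Qed.

End affine_kernel.

(** If Y is a function of the first block of a standard Gaussian vector and
    X = x + B1 Y + B2 (second block), then, the blocks being independent, freezing
    Y = y leaves the law of the second block unchanged. Formally, both sides are
    the integral over the first block of the measure of the section at that point
    of {X in B and Y in C}, seen as a subset of the product. *)
Lemma affine_kernel_regular_conditional (R : realType) (dd : measure_display)
    (T : measurableType dd) (P : probability T R) (m d n l : nat)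
    (Q : {RV P >-> 'cV[R]_(m + d)}) (X : {RV P >-> 'cV[R]_n}) (Y : {RV P >-> 'cV[R]_l})
    (f : 'cV[R]_m -> 'cV[R]_l) (x : 'cV[R]_n) (B1 : 'M[R]_(n, l)) (B2 : 'M[R]_(n, d)) :
  gaussian (distribution P Q) 0 1%:M -> measurable_fun setT f ->
  (forall w, Y w = f (usubmx (Q w))) ->
  (forall w, X w = affine_map (x + B1 *m Y w) B2 (dsubmx (Q w))) ->
  regular_conditional X Y
    (affine_kernel x B1 B2 (@dsubmx R m d 1 \o Q : {RV P >-> 'cV[R]_d})).
Proof.
move=> gQ mf YE XE B C mB mC.
set K := affine_kernel _ _ _ _.
pose Q1 : {RV P >-> 'cV[R]_m} := @usubmx R m d 1 \o Q.
pose Q2 : {RV P >-> 'cV[R]_d} := @dsubmx R m d 1 \o Q.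
have g1 : gaussian (distribution P Q1) 0 1%:M by exact: gaussian_usubmx gQ.
have g2 : gaussian (distribution P Q2) 0 1%:M by exact: gaussian_dsubmx gQ.
pose h (q : 'cV[R]_(m + d)) := affine_map (x + B1 *m f (usubmx q)) B2 (dsubmx q).
have mfu : measurable_fun setT (fun q : 'cV[R]_(m + d) => f (usubmx q)).
  exact: (measurableT_comp mf (@measurable_usubmx R m d)).
have mh : measurable_fun setT h.
  have -> : h = affine_map x (row_mx B1 B2) \o @stack R l d \o
      (fun q => (f (usubmx q), dsubmx q)).
    by apply/funext => q; rewrite /h /affine_map /stack /= mul_row_col addrA.
  apply: measurableT_comp; first exact: measurable_funPT.
  exact: (measurable_fun_pair mfu (@measurable_dsubmx R m d)).
pose D : set 'cV[R]_(m + d) := (h @^-1` B) `&` ((fun q => f (usubmx q)) @^-1` C).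
have mD : measurable D.
  by apply: measurableI; rewrite -[X in measurable X]setTI; [exact: mh|exact: mfu].
transitivity (distribution P Q D).
  by congr (P _); apply/seteqP; split => w /=; rewrite /h XE YE.
rewrite (standard_gaussian_blocks gQ g1 g2 mD) /= /product_measure1.
have KB : measurable_fun setT (K ^~ B) by exact: measurable_kernel.
rewrite (ge0_integral_pushforward (measurable_funPT Y)); first last.
- by move=> y _; exact: measure_ge0.
- exact: measurable_funTS.
- exact: mC.
have -> : Y @^-1` C = Q1 @^-1` (f @^-1` C) by apply/seteqP; split => w /=; rewrite YE.
have mfC : measurable (f @^-1` C) by rewrite -[X in measurable X]setTI; exact: mf.
transitivity (\int[distribution P Q1]_(q in f @^-1` C) K (f q) B)%E; last first.
  rewrite (ge0_integral_pushforward (measurable_funPT Q1)); first last.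
  - by move=> q _; exact: measure_ge0.
  - by apply: measurable_funTS; exact: (measurableT_comp KB mf).
  - exact: mfC.
  by apply: eq_integral => w _; rewrite /= YE.
rewrite [RHS]integral_mkcond; apply: eq_integral => q _.
rewrite patchE; case: ifPn => [|/negP]; rewrite inE/= => Cq.
  congr (P _); apply/seteqP; split => w /=.
    by move=> /xsectionP[]; rewrite /stack /h /= col_mxKu col_mxKd.
  by move=> Bq; apply/xsectionP; split; rewrite /= /stack /h /= ?col_mxKu ?col_mxKd.
rewrite (_ : xsection _ q = set0) ?measure0//.
apply/seteqP; split => // z /xsectionP[_]; rewrite /= /stack col_mxKu.
by move=> /Cq.
Qed.

(** * Uniqueness of continuous conditional laws *)

(** A countable determining class, needed to exchange an almost-everywhere
    statement with a quantification over sets. *)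
Lemma rational_halflines_determine (R : realType) (mu nu : probability R R) :
  (forall q : rat, mu `]ratr q, +oo[%classic = nu `]ratr q, +oo[%classic) ->
  forall B, measurable B -> mu B = nu B.
Proof.
move=> munu.
apply: (measure_unique (range (fun q : rat => `](ratr q : R), +oo[%classic))
  (fun k => `](ratr (- k%:R) : R), +oo[%classic)).
- apply/seteqP; split; last first.
    by apply: smallest_sub; [exact: sigma_algebra_measurable
      |move=> _ [q _ <-]; exact: measurable_itv].
  have mE : @measurable _ R = <<s @RGenOInfty.G R >> := RGenOInfty.measurableE R.
  rewrite mE; apply: smallest_sub; first exact: smallest_sigma_algebra.
  move=> _ [a ->].
  rewrite (_ : `]a, +oo[%classic =
      \bigcup_(q in [set q : rat | a < ratr q]) `](ratr q : R), +oo[%classic).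
    rewrite bigcup_mkcond.
    apply: (@countable_bigcupT_measurable _ (g_sigma_algebraType
      (range (fun q : rat => `](ratr q : R), +oo[%classic)))) => // q.
    by case: ifPn => // _; apply: sub_sigma_algebra; exists q.
  apply/seteqP; split => r /=; rewrite in_itv/= andbT.
    move=> /rat_in_itvoo[q]; rewrite in_itv/= => /andP[aq qr].
    by exists q => //=; rewrite in_itv/= qr.
  by move=> [q /= aq]; rewrite in_itv/= andbT; exact: lt_trans.
- move=> _ _ [p _ <-] [q _ <-]; exists (Num.max p q) => //.
  apply/seteqP; split => r /=; rewrite !in_itv/= !andbT.
    by case: (leP p q) => pq h; split => //; apply: le_lt_trans h;
      rewrite ler_rat// ltW.
  by move=> [pr qr]; case: (leP p q).
- by move=> k; exists (- k%:R).
- apply/seteqP; split => // r _; exists (Num.bound `|r|) => //=.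
  rewrite in_itv/= andbT rmorphN/= ratr_nat ltrNl (le_lt_trans _ (archi_boundP (normr_ge0 r)))//.
  by rewrite -normrN ler_norm.
- by move=> _ [q _ <-]; exact: munu.
- by move=> k; rewrite (le_lt_trans (probability_le1 _ _)) ?ltry//; exact: measurable_itv.
Qed.

Section kernel_law.
Context (R : realType) d1 d2 (S : measurableType d1) (T : measurableType d2).
Variables (K : R.-pker S ~> T) (y : S).

(** [K y] is typed as a mere measure; this name carries its structure of
    probability measure. *)
Definition kernel_law : set T -> \bar R := K y.

HB.instance Definition _ := Measure.on kernel_law.

Let kernel_law_setT : kernel_law setT = 1%E.
Proof. exact: prob_kernel. Qed.

HB.instance Definition _ := Measure_isProbability.Build _ _ _ kernel_law kernel_law_setT.

End kernel_law.

Section uniqueness.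
Context (R : realType) (dd : measure_display) (T : measurableType dd)
  (P : probability T R) (n l : nat) (X : {RV P >-> 'cV[R]_n}) (Y : {RV P >-> 'cV[R]_l}).
Variables (K1 K2 : R.-pker 'cV[R]_l ~> 'cV[R]_n).
Hypothesis K1X : continuous_conditional X Y K1.
Hypothesis K2X : continuous_conditional X Y K2.

Let ae_eq_kernels (B : set 'cV[R]_n) : measurable B ->
  ae_eq (distribution P Y) setT (K1 ^~ B) (K2 ^~ B).
Proof.
move=> mB; apply: integral_ae_eq => //.
- apply: (@le_integrable _ _ _ (distribution P Y) setT measurableT _ (cst 1%E)).
  + exact: measurable_kernel.
  + move=> y _; rewrite /= gee0_abs// normr1.
    by rewrite -(@prob_kernel _ _ _ _ _ K1 y) le_measure// inE.
  + by apply: (@bounded_measurable_integrable _ _ _ (distribution P Y) (cst 1));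
      exact: bounded_measurable_cst.
- exact: measurable_kernel.
- by move=> C _ mC; rewrite -K1X.1// -K2X.1.
Qed.

Let functional_law (K : R.-pker 'cV[R]_l ~> 'cV[R]_n) y (t : 'cV[R]_n) : probability R R :=
  distribution (kernel_law K y) (inner t : {RV (kernel_law K y) >-> R}).

(** For each half-line the two kernels agree outside a null set of y; countably
    many half-lines have a common null set. *)
Let ae_functional_laws t : {ae distribution P Y, forall y,
  forall B : set R, measurable B -> functional_law K1 y t B = functional_law K2 y t B}.
Proof.
pose q_ (k : nat) : rat := odflt 0 (unpickle k).
pose H (k : nat) : set R := `](ratr (q_ k)), +oo[%classic.
have mH k : measurable (inner t @^-1` H k).
  by rewrite -[X in measurable X]setTI; apply: measurable_dot => //; exact: measurable_itv.
have := ae_foralln (fun k => ae_eq_kernels (mH k)).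
apply: filterS => y Hy; apply: rational_halflines_determine => q.
by have := Hy (pickle q) I; rewrite /H /q_ pickleK.
Qed.

Let cos_functional (K : R.-pker 'cV[R]_l ~> 'cV[R]_n) (t : 'cV[R]_n) (p : R) y :
  \int[K y]_z cos (inner t z + p) = \int[functional_law K y t]_r cos (r + p).
Proof.
rewrite /functional_law expectation_distribution//.
by apply: bounded_measurable_cos; exact: measurable_funD.
Qed.

Let continuous_cos_kernel (K : R.-pker 'cV[R]_l ~> 'cV[R]_n) (t : 'cV[R]_n) (p : R) :
  weakly_continuous K -> continuous (fun y => \int[K y]_z cos (inner t z + p)).
Proof.
apply; last by exists 1 => z; rewrite ler_norml cos_geN1 cos_le1.
move=> z; have ct : inner t w @[w --> z] --> inner t z.
  apply: (cvg_comp (mulmx t^T : 'cV[R]_n -> 'cV[R]_1) (fun w : 'cV[R]_1 => w 0 0)).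
    exact: continuous_mulmx.
  exact: coord_continuous.
have ctp : inner t w + p @[w --> z] --> inner t z + p by apply: cvgD ct _; exact: cvg_cst.
exact: (cvg_comp _ _ ctp (@continuous_cos R _)).
Qed.

(** The points y at which K1 and K2 give the same law to a functional have full
    measure. The difference F of the expectations of a cosine of that functional
    is continuous and vanishes there; if it did not vanish at y0, it would not
    vanish on a neighbourhood of y0, which has positive measure. Cosines determine
    the two measures at y0. *)
Theorem continuous_conditional_unique (y0 : 'cV[R]_l) :
  (forall U, measurable U -> nbhs y0 U -> (0 < distribution P Y U)%E) ->
  forall B, measurable B -> K1 y0 B = K2 y0 B.
Proof.
move=> charged.
apply: (@cos_expectations_determine _ _ (kernel_law K1 y0) (kernel_law K2 y0)) => t p.
pose F y := \int[K1 y]_z cos (inner t z + p) - \int[K2 y]_z cos (inner t z + p).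
have cF : continuous F.
  move=> y; apply: (@cvgB _ _ _ (nbhs y));
    [exact: (@continuous_cos_kernel K1 t p K1X.2 y)
    |exact: (@continuous_cos_kernel K2 t p K2X.2 y)].
suff : F y0 = 0 by move/eqP; rewrite subr_eq0 => /eqP.
apply: contrapT => /eqP F0.
pose U := F @^-1` [set r | r != 0].
have mU : measurable U.
  rewrite -[X in measurable X]setTI; apply: (continuous_measurable_cV cF) => //.
  rewrite (_ : [set r | _] = ~` [set 0]); first exact: measurableC.
  by apply/seteqP; split => r /= => [/eqP//|h]; apply/eqP.
have nU : nbhs y0 U by apply: (cF y0); exact: (open_nbhs_nbhs (conj (@open_neq R 0) F0)).
have [N [mN N0 UN]] := ae_functional_laws t.
have : (distribution P Y U <= distribution P Y N)%E.
  apply: le_measure; rewrite ?inE// => y Uy; apply: UN => /= lawy.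
  move: Uy; rewrite /U /= /F !cos_functional => /eqP; apply; apply/eqP.
  rewrite subr_eq0; apply/eqP; congr fine.
  by apply: eq_measure_integral => A mA _; exact: lawy.
by rewrite [leRHS]N0 leNgt charged.
Qed.

End uniqueness.

(** * Conditioning the approximated Krylov prior *)

Section krylov_columns.
Context (R : realType) (n : nat).
Implicit Types (A : 'M[R]_n) (r : 'cV[R]_n) (v : nat -> 'cV[R]_n).

Lemma col_cols v o k (j : 'I_k) : col j (cols v o k) = v (o + j).+1.
Proof. by apply/colP => i; rewrite !mxE. Qed.

Lemma cols_split v m d : cols v 0 (m + d) = row_mx (cols v 0 m) (cols v m d).
Proof.
apply/matrixP => i j; case: (split_ordP j) => l ->.
  by rewrite row_mxEl !mxE.
by rewrite row_mxEr !mxE.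
Qed.

Lemma sqrtPhi_split r v m d :
  sqrtPhi r v 0 (m + d) = block_mx (sqrtPhi r v 0 m) 0 0 (sqrtPhi r v m d).
Proof.
rewrite /sqrtPhi -diag_mx_row; congr diag_mx; apply/rowP => j.
by case: (split_ordP j) => l ->; rewrite ?row_mxEl ?row_mxEr !mxE.
Qed.

Lemma sqrtPhiK r v o k : sqrtPhi r v o k *m (sqrtPhi r v o k)^T = Phi r v o k.
Proof.
rewrite /sqrtPhi tr_diag_mx mulmx_diag; congr diag_mx; apply/rowP => j.
by rewrite !mxE -expr2 sqr_sqrtr// sqr_ge0.
Qed.

Lemma cols_sqrtPhi_cov r v o k :
  cols v o k *m sqrtPhi r v o k *m 1%:M *m (cols v o k *m sqrtPhi r v o k)^T =
  cols v o k *m Phi r v o k *m (cols v o k)^T.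
Proof. by rewrite mulmx1 trmx_mul mulmxA -(mulmxA (cols v o k)) sqrtPhiK. Qed.

Lemma gram_entry A v o k o' k' (i : 'I_k) (j : 'I_k') :
  ((cols v o k)^T *m A *m cols v o' k') i j =
  ((v (o + i).+1)^T *m A *m v (o' + j).+1) 0 0.
Proof.
rewrite -(col_cols v o i) -(col_cols v o' j) tr_col colE mulmxA -!row_mul -colE.
by rewrite !mxE.
Qed.

(** A block of the identity matrix V^T A V, located by the offsets o and o'. *)
Lemma gram_sub A r g v o k o' k' : krylov_basis A r g v ->
  (o + k <= g)%N -> (o' + k' <= g)%N ->
  (cols v o k)^T *m A *m cols v o' k' = \matrix_(i, j) ((o + i)%N == (o' + j)%N)%:R.
Proof.
move=> [VAV _] okg okg'; apply/matrixP => i j; rewrite gram_entry.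
have ig : (o + i < g)%N by rewrite (leq_trans _ okg)// ltn_add2l.
have jg : (o' + j < g)%N by rewrite (leq_trans _ okg')// ltn_add2l.
have := gram_entry A v 0 0 (Ordinal ig) (Ordinal jg).
by rewrite VAV mxE -val_eqE /= !add0n => <-; rewrite mxE.
Qed.

End krylov_columns.
Theorem theorem15 (R : realType) (n : nat) (A : 'M[R]_n) (b xstar x0 : 'cV[R]_n)
    (g : nat) (v : nat -> 'cV[R]_n) (m d : nat)
    (disp : measure_display) (Omega : measurableType disp)
    (P : probability Omega R) (Q : {RV P >-> 'cV[R]_(m + d)}) :
  let r0 := b - A *m x0 in
  sym_pos_def A ->
  A *m xstar = b ->
  r0 != 0 ->
  grade A r0 g ->
  krylov_basis A r0 g v ->
  (1 <= d)%N ->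
  (1 <= m < g - d)%N ->
  gaussian (distribution P Q) 0 1%:M ->
  let X : {RV P >-> 'cV[R]_n} :=
    affine_map x0 (cols v 0 (m + d) *m sqrtPhi r0 v 0 (m + d)) \o Q in
  let Y : {RV P >-> 'cV[R]_m} := mulmx ((cols v 0 m)^T *m A) \o X in
  gaussian (distribution P X) x0 (prior_approx_cov r0 v (m + d)) /\
  (exists K : R.-pker 'cV[R]_m ~> 'cV[R]_n, continuous_conditional X Y K) /\
  (forall K : R.-pker 'cV[R]_m ~> 'cV[R]_n, continuous_conditional X Y K ->
    gaussian (K ((cols v 0 m)^T *m b))
      (posterior_mean x0 r0 v m) (posterior_approx_cov r0 v m d)).
Proof.
move=> r0 _ _ _ _ basis _ /andP[_ mgd] gQ X Y.
have mdg : (m + d <= g)%N.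
  by rewrite addnC -leq_subRL ?(ltnW mgd)// ltnW// -subn_gt0 (leq_trans _ mgd).
set V1 := cols v 0 m; set V2 := cols v m d.
set S1 := sqrtPhi r0 v 0 m; set S2 := sqrtPhi r0 v m d.
set C := V1^T *m A; set y0 := V1^T *m b.
have mg : (0 + m <= g)%N by rewrite (leq_trans _ mdg)// leq_addr.
have CV1 : C *m V1 = 1%:M.
  by rewrite (gram_sub basis)//; apply/matrixP => i j; rewrite !mxE.
have CV2 : C *m V2 = 0.
  rewrite (gram_sub basis)//; apply/matrixP => i j; rewrite !mxE.
  by rewrite add0n ltn_eqF// (leq_trans (ltn_ord i))// leq_addr.
have VS : cols v 0 (m + d) *m sqrtPhi r0 v 0 (m + d) = row_mx (V1 *m S1) (V2 *m S2).
  by rewrite cols_split sqrtPhi_split mul_row_block !mulmx0 addr0 add0r.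
pose Q2 : {RV P >-> 'cV[R]_d} := @dsubmx R m d 1 \o Q.
pose Q1 : {RV P >-> 'cV[R]_m} := @usubmx R m d 1 \o Q.
have g1 : gaussian (distribution P Q1) 0 1%:M by exact: gaussian_usubmx gQ.
have g2 : gaussian (distribution P Q2) 0 1%:M by exact: gaussian_dsubmx gQ.
have XQ w : X w = x0 + (V1 *m (S1 *m usubmx (Q w)) + V2 *m (S2 *m dsubmx (Q w))).
  by rewrite /X /= /affine_map VS -{1}(vsubmxK (Q w)) mul_row_col !mulmxA.
have YQ w : Y w = affine_map (C *m x0) S1 (usubmx (Q w)).
  have -> : Y w = C *m X w by [].
  rewrite XQ /affine_map !mulmxDr !(mulmxA C) CV1 CV2 mul1mx mul0mx.
  by rewrite addr0.
(* Y determines the component of X along V_(1:m), so X is affine in Y and Q2. *)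
pose K0 : R.-pker 'cV[R]_m ~> 'cV[R]_n :=
  affine_kernel (x0 - V1 *m (C *m x0)) V1 (V2 *m S2) Q2.
have K0X : continuous_conditional X Y K0.
  split; last exact: affine_kernel_weakly_continuous.
  apply: (affine_kernel_regular_conditional gQ _ YQ); first exact: measurable_funPT.
  move=> w; rewrite XQ YQ /affine_map mulmxDr -!mulmxA.
  by rewrite !addrA subrK.
split.
  have := gaussian_affine_image x0 (cols v 0 (m + d) *m sqrtPhi r0 v 0 (m + d)) gQ.
  by rewrite mulmx0 addr0 cols_sqrtPhi_cov.
split; first by exists K0.
move=> K KX.
have gK0 : gaussian (K0 y0) (posterior_mean x0 r0 v m) (posterior_approx_cov r0 v m d).
  have mean : x0 - V1 *m (C *m x0) + V1 *m y0 = posterior_mean x0 r0 v m.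
    by rewrite /posterior_mean -/V1 /r0 mulmxBr /y0 /C !mulmxA addrAC [RHS]addrA.
  have := gaussian_affine_image (x0 - V1 *m (C *m x0) + V1 *m y0) (V2 *m S2) g2.
  by rewrite mulmx0 addr0 cols_sqrtPhi_cov -mean.
have charged U : measurable U -> nbhs y0 U -> (0 < distribution P Y U)%E.
  move=> mU nU.
  (* The noise eps reproduces the data: its entries are the signs of v_i^T r0 and
     those of the square root of Phi are the absolute values |v_i^T r0|. *)
  pose a (i : 'I_m) := ((v i.+1)^T *m r0) 0 0.
  pose eps : 'cV[R]_m := \col_i Num.sg (a i).
  have feps : affine_map (C *m x0) S1 eps = y0.
    have S1eps : S1 *m eps = V1^T *m r0.
      apply/colP => i; transitivity (a i).
        by rewrite mul_diag_mx !mxE sqrtr_sqr mulrC -numEsg.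
      by rewrite /a !mxE; apply: eq_bigr => j _; rewrite !mxE.
    by rewrite /affine_map S1eps /r0 mulmxBr addrC /C mulmxA subrK.
  have : nbhs eps (affine_map (C *m x0) S1 @^-1` U).
    by apply: (@continuous_affine_map R m m (C *m x0) S1 eps); rewrite feps.
  move=> /nbhs_cVP[e e0 eU].
  have box := standard_gaussian_box_gt0 eps g1 e0.
  apply: lt_le_trans box _; rewrite -[leRHS]/(P (Y @^-1` U)).
  apply: (@le_measure _ _ _ P); rewrite ?inE.
  - by apply: (measurable_funPTI Q1); exact: measurable_box.
  - exact: (measurable_funPTI Y).
  - by move=> w /= /eU; rewrite /= -YQ.
have KK0 := continuous_conditional_unique KX K0X charged.
split; first exact: gK0.1.
move=> t B mB; rewrite -(gK0.2 t B mB); apply: KK0.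
by rewrite -[X in measurable X]setTI; apply: measurable_dot.
Qed.
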